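(* Let $Q$ be a prime with $Q\equiv 10 \pmod{11}$. Then $\bar p(11Q^3n)\equiv 0 \pmod{11}$ for all positive integers $n$ coprime to $Q$.
   Context: An overpartition of $n$ is a non-increasing sequence of positive integers with sum $n$ in which the first occurrence of each integer may be overlined. $\bar p(n)$ denotes the number of overpartitions of $n$ (with $\bar p(0)=1$); its generating function is $\sum_{n\ge 0}\bar p(n)q^n=\prod_{n\ge 1}\frac{1+q^n}{1-q^n}$. *)

(* Defs.v *)
From mathcomp Require Import all_boot.

Set Implicit Arguments.
Unset Strict Implicit.
Unset Printing Implicit Defensive.

(* The pair (m, b) is the part m, overlined when b = true. *)
Definition is_overpartition (n : nat) (s : seq (nat * bool)) : bool :=
  [&& sorted geq (unzip1 s),
      0 \notin unzip1 s,
      sumn (unzip1 s) == n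
    & all (fun i => (nth (0, false) s i).2 ==>
                    (nth 0 (unzip1 s) i \notin take i (unzip1 s)))
          (iota 0 (size s))].

Definition erase_bound (n : nat) (s : seq ('I_n.+1 * bool)) :
  seq (nat * bool) := [seq (val x.1, x.2) | x <- s].

(* An overpartition of n has at most n parts, each at most n, so the bounds
   in the type only serve to make it finite; see overpartition_bounded. *)
Definition overpartitions (n : nat) : {set n.-bseq ('I_n.+1 * bool)} :=
  [set s : n.-bseq ('I_n.+1 * bool) | is_overpartition n (erase_bound s)].

Definition pbar (n : nat) : nat := #|overpartitions n|.

Lemma erase_bound_inj (n : nat) : injective (@erase_bound n).
Proof. by apply: inj_map => -[x b] [y c] [/val_inj -> ->]. Qed.

Lemma overpartition_bounded (n : nat) (s : seq (nat * bool)) :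
  is_overpartition n s ->
  exists2 t, t \in overpartitions n & erase_bound t = s.
Proof.
move=> hs; have /and4P[_ s0 /eqP sn _] := hs.
have szs : size s <= n.
  rewrite -sn; elim: s s0 {hs sn} => //= -[m b] s IHs.
  rewrite inE negb_or eq_sym -lt0n => /andP[m0 /IHs h].
  by rewrite -add1n leq_add.
have les : all (fun x => x.1 <= n) s.
  rewrite -sn; elim: s {hs s0 sn szs} => //= x s IHs.
  rewrite leq_addr; apply: sub_all IHs => y /leq_trans; apply.
  exact: leq_addl.
pose u := [seq (inord x.1 : 'I_n.+1, x.2) | x <- s].
have uE : erase_bound u = s.
  rewrite /erase_bound -map_comp map_id_in // => -[m b] /(allP les) /= le_m.
  by rewrite inordK.
have szu : size u <= n by rewrite size_map.
by exists (Bseq szu); rewrite ?inE /= uE.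
Qed.

(* Main.v *)
(* Put phi(q) = sum_(k in Z) q^(k^2), w = phi(-q), x = w^4, z = phi(q)^4 and
   y = z - x, the fourth powers of the Jacobi theta functions, and D = q d/dq.
   By Gauss, sum pbar(n) q^n = 1/w.

   Modulo 11.  With l = y/z one has D l = x l, and a polynomial h of degree 5
   satisfies z^5 h(l) = 1 (this is E_10 = 1 mod 11).  Both facts follow from the
   Landen transformation q -> q^2.  Up to an 11-th power, 1/w then becomes
   x h(l)^3 (1 - l)^7, and x l^k is an exact derivative unless 11 divides k.
   Since h^3 (1 - l)^7 has coefficients 1, 0, -1 at l^0, l^11, l^22,
   extracting the exponents divisible by 11 gives
     sum pbar(11n) q^n = w x (y + z) mod 11.

   In weight 4, Liouville's elementary convolution for sigma over odd integers
   shows that the coefficient of q^n in x (y + z), for n > 0, is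
   16 (16 sigma_3(n/4) - (-1)^n sigma_3(n)).  So if n is not a square, then
     pbar(11n) = 16 (-1)^n (16 S(n) - S(4n)) mod 11,
   where S(N) = sum_b sigma_3((N - b^2)/4) = sum a^3, the last sum over the
   forms -a X^2 + b X Y + c Y^2 of discriminant N with a, c > 0.

   Zagier: for N not a square, the sum of f(x)^3 over the quadratic polynomials
     f
   of discriminant N with negative leading coefficient and f(x) > 0 does not
   depend on the rational number x.  Letting the matrices of determinant Q act
   on forms, this yields S(Q^2 N) = (1 + Q^7) S(N) whenever Q divides N exactly
   once, and 1 + Q^7 = 0 mod 11. *)
Require Import Defs.
From HB Require Import structures.
From mathcomp Require Import all_boot all_order all_algebra.
From mathcomp Require Import boolp classical_sets functions cardinality fsbigop.
From mathcomp Require Import zify ring.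

Set Implicit Arguments.
Unset Strict Implicit.
Unset Printing Implicit Defensive.

Import Order.TTheory GRing.Theory Num.Theory.

Local Open Scope ring_scope.

(** * Formal power series *)

Record fps (R : Type) := Fps {coef :> nat -> R}.

Lemma fpsP (R : Type) (f g : fps R) : f =1 g -> f = g.
Proof. by case: f g => [f] [g] /= /funext ->. Qed.

HB.instance Definition _ (R : Type) := gen_eqMixin (fps R).
HB.instance Definition _ (R : Type) := gen_choiceMixin (fps R).

(* Locked, lest simplification replace coefficients of products by sums. *)
HB.lock Definition fmul (R : comNzRingType) (f g : fps R) :=
  Fps (fun n => \sum_(i < n.+1) f i * g (n - i)%N).

Arguments fmul {R}.

Section Ring.
Variable R : comNzRingType.
Implicit Types f g h : fps R.

Definition fadd f g := Fps (fun n => f n + g n).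
Definition fopp f := Fps (fun n => - f n).
Definition fzero := Fps (fun _ => 0 : R).
Definition fone := Fps (fun n => (n == 0%N)%:R : R).
Lemma fmulE f g n : fmul f g n = \sum_(i < n.+1) f i * g (n - i)%N.
Proof. by rewrite unlock. Qed.

Lemma faddA : associative fadd.
Proof. by move=> f g h; apply: fpsP => n /=; rewrite addrA. Qed.
Lemma faddC : commutative fadd.
Proof. by move=> f g; apply: fpsP => n /=; rewrite addrC. Qed.
Lemma fadd0 : left_id fzero fadd.
Proof. by move=> f; apply: fpsP => n /=; rewrite add0r. Qed.
Lemma faddN : left_inverse fzero fopp fadd.
Proof. by move=> f; apply: fpsP => n /=; rewrite addNr. Qed.

HB.instance Definition _ :=
  GRing.isZmodule.Build (fps R) faddA faddC fadd0 faddN.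

Definition trunc N f : {poly R} := \poly_(i < N) f i.

Lemma coef_trunc N f i : (i < N)%N -> (trunc N f)`_i = f i.
Proof. by move=> lt_iN; rewrite coef_poly lt_iN. Qed.

(** The coefficient of q^n in a product involves only exponents up to n, so the ring laws of series
    are inherited from those of polynomials. *)
Lemma coef_fmul N f g (p q : {poly R}) n : (n < N)%N ->
    (forall i, (i < N)%N -> p`_i = f i) ->
    (forall i, (i < N)%N -> q`_i = g i) ->
  (p * q)`_n = fmul f g n.
Proof.
move=> ltnN hp hq; rewrite coefM fmulE; apply: eq_bigr => i _.
have := ltn_ord i; rewrite ltnS => le_in.
by rewrite hp ?hq //; lia.
Qed.

Lemma coef_trunc_mul N f g n : (n < N)%N ->
  (trunc N f * trunc N g)`_n = fmul f g n.
Proof. by move=> ltnN; apply: coef_fmul ltnN _ _ => i; apply: coef_trunc. Qed.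

Lemma fmulA : associative (@fmul R).
Proof.
move=> f g h; apply: fpsP => n.
have ltnn := ltnSn n.
rewrite -(coef_fmul (p := trunc n.+1 f) (q :=
  trunc n.+1 g * trunc n.+1 h) ltnn).
- rewrite mulrA; apply: coef_fmul ltnn _ _ => i lt_i; last exact: coef_trunc.
  by rewrite coef_trunc_mul.
- by move=> i; apply: coef_trunc.
by move=> i lt_i; rewrite coef_trunc_mul.
Qed.

Lemma fmulC : commutative (@fmul R).
Proof.
by move=> f g; apply: fpsP => n; rewrite -!(coef_trunc_mul _ _ (ltnSn n)) mulrC.
Qed.

Lemma fmul1 : left_id fone (@fmul R).
Proof.
move=> f; apply: fpsP => n.
rewrite fmulE big_ord_recl /= mul1r subn0 big1 ?addr0 // => i _.
by rewrite mul0r.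
Qed.

Lemma fmulDl : left_distributive (@fmul R) fadd.
Proof.
move=> f g h; apply: fpsP => n /=; rewrite !fmulE -big_split /=.
by apply: eq_bigr => i _; rewrite mulrDl.
Qed.

Lemma fone_neq0 : fone != fzero.
Proof.
apply/eqP => /(congr1 (fun f : fps R => f 0%N)) /= /eqP.
by rewrite oner_eq0.
Qed.

HB.instance Definition _ :=
  GRing.Zmodule_isComNzRing.Build (fps R) fmulA fmulC fmul1 fmulDl fone_neq0.

End Ring.

(** * Coefficients, the substitutions q -> q^k ([dil]) and q -> -q ([neg]), and the derivation q
    d/dq ([derf]) *)

Section Operators.
Variable R : comNzRingType.
Implicit Types f g h : fps R.

Lemma coefDf f g n : (f + g) n = f n + g n. Proof. by []. Qed.
Lemma coefNf f n : (- f) n = - f n. Proof. by []. Qed.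
Lemma coefBf f g n : (f - g) n = f n - g n. Proof. by []. Qed.
Lemma coef1f n : (1 : fps R) n = (n == 0%N)%:R. Proof. by []. Qed.
Lemma coefMf f g n : (f * g) n = \sum_(i < n.+1) f i * g (n - i)%N.
Proof. exact: fmulE. Qed.
Lemma coef_mul0 f g : (f * g) 0%N = f 0%N * g 0%N.
Proof. by rewrite coefMf big_ord1. Qed.
Lemma coefMnf f k n : (f *+ k) n = f n *+ k.
Proof. by elim: k => [|k IHk]; rewrite ?mulr0n // !mulrS coefDf IHk. Qed.
Lemma coef_exp0 f k : (f ^+ k) 0%N = f 0%N ^+ k.
Proof. by elim: k => [|k IHk] //; rewrite !exprS coef_mul0 IHk. Qed.
Lemma coef_sumf (I : Type) (r : seq I) (P : pred I) (F : I -> fps R) n :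
  (\sum_(i <- r | P i) F i) n = \sum_(i <- r | P i) F i n.
Proof. by elim/big_rec2: _ => // i u v _ <-. Qed.

Lemma truncM_coef N f g n : (n < N)%N ->
  (trunc N f * trunc N g)`_n = (f * g) n.
Proof. exact: coef_trunc_mul. Qed.

Definition fX : fps R := Fps (fun n => (n == 1)%:R).

Lemma coef_fXnM k f n : (fX ^+ k * f) n = if (n < k)%N then 0 else f (n - k)%N.
Proof.
elim: k n => [|k IHk] n; first by rewrite mul1r subn0.
rewrite exprS -mulrA coefMf; case: n => [|n].
  by rewrite big_ord1 mul0r.
rewrite 2!big_ord_recl mul0r add0r mul1r big1 ?addr0; last first.
  by move=> i _; rewrite mul0r.
by rewrite IHk lift0 ltnS subSS subn0.
Qed.

Lemma coef_fXn k n : (fX ^+ k) n = (n == k)%:R.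
Proof.
rewrite -[fX ^+ k]mulr1 coef_fXnM coef1f subn_eq0.
by case: ltngtP.
Qed.

Definition dil k f : fps R := Fps (fun n => if (k %| n)%N then f (n %/ k)%N else
  0).

Lemma coef_dil k f n :
  dil k f n = if (k %| n)%N then f (n %/ k)%N else 0.
Proof. by []. Qed.

Lemma dil_is_zmod_morphism k : zmod_morphism (dil k).
Proof.
by move=> f g; apply: fpsP => n /=; case: ifP; rewrite ?subr0.
Qed.

Lemma dil_is_monoid_morphism k : (0 < k)%N -> monoid_morphism (dil k).
Proof.
move=> k_gt0; split=> [|f g]; apply: fpsP => n.
  rewrite coef_dil !coef1f; case: ifP => [/dvdnP[m ->]|].
    by rewrite mulnK // muln_eq0 (gtn_eqF k_gt0) orbF.
  by case: n => //; rewrite dvdn0.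
(* On truncations the substitution is composition with ['X^k], which is multiplicative. *)
have cdil u i : (i < n.+1)%N -> (trunc n.+1 u \Po 'X^k)`_i = dil k u i.
  move=> lt_i; rewrite coef_comp_poly_Xn //=; case: ifP => // _.
  by rewrite coef_trunc // (leq_ltn_trans (leq_div _ _)).
rewrite -(coef_fmul (ltnSn n) (cdil f) (cdil g)) -comp_polyM.
rewrite coef_comp_poly_Xn //=; case: ifP => // _.
by rewrite truncM_coef // ltnS leq_div.
Qed.

Definition neg f : fps R := Fps (fun n => (-1) ^+ n * f n).

Lemma coef_neg f n : neg f n = (-1) ^+ n * f n. Proof. by []. Qed.

Lemma neg_is_zmod_morphism : zmod_morphism neg.
Proof. by move=> f g; apply: fpsP => n /=; rewrite mulrBr. Qed.

Lemma neg_is_monoid_morphism : monoid_morphism neg.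
Proof.
split=> [|f g]; apply: fpsP => n.
  by rewrite coef_neg coef1f; case: n => [|n]; rewrite ?mul1r ?mulr0.
rewrite coef_neg !coefMf mulr_sumr; apply: eq_bigr => i _ /=.
have := ltn_ord i; rewrite ltnS => le_in.
by rewrite mulrACA -exprD subnKC.
Qed.

HB.instance Definition _ := GRing.isZmodMorphism.Build _ _ neg
  neg_is_zmod_morphism.
HB.instance Definition _ := GRing.isMonoidMorphism.Build _ _ neg
  neg_is_monoid_morphism.

Lemma negK : involutive neg.
Proof.
move=> f; apply: fpsP => n /=.
by rewrite mulrA -exprD addnn -mul2n exprM sqrrN !expr1n mul1r.
Qed.

Definition derf f : fps R := Fps (fun n => n%:R * f n).

Lemma coef_derf f n : derf f n = n%:R * f n. Proof. by []. Qed.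

Lemma derf_is_zmod_morphism : zmod_morphism derf.
Proof. by move=> f g; apply: fpsP => n /=; rewrite mulrBr. Qed.

HB.instance Definition _ := GRing.isZmodMorphism.Build _ _ derf
  derf_is_zmod_morphism.

Lemma derfM f g : derf (f * g) = derf f * g + f * derf g.
Proof.
apply: fpsP => n; rewrite coef_derf coefDf !coefMf mulr_sumr -big_split /=.
apply: eq_bigr => i _; have := ltn_ord i; rewrite ltnS => le_in.
by rewrite -{1}(subnKC le_in) natrD; ring.
Qed.

Lemma derf1 : derf 1 = 0.
Proof. by apply: fpsP => -[|n]; rewrite coef_derf coef1f ?mul0r ?mulr0. Qed.

Lemma derfX f n : derf (f ^+ n) = n%:R * f ^+ n.-1 * derf f.
Proof.
elim: n => [|[|n] IHn]; first by rewrite derf1 !mul0r.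
  by rewrite !mul1r.
rewrite exprS derfM IHn /= -[n.+2]addn1 natrD [f ^+ n.+1]exprS; ring.
Qed.

Lemma derf_fX k : derf (fX ^+ k) = k%:R * fX ^+ k.
Proof.
apply: fpsP => n; rewrite mulr_natl coefMnf coef_derf coef_fXn.
by case: eqP => [->|_]; rewrite ?mulr0 ?mul0rn // mulr1.
Qed.

Lemma derf_dil k f : derf (dil k f) = k%:R * dil k (derf f).
Proof.
apply: fpsP => n; rewrite mulr_natl coefMnf /=.
case: ifP => [/dvdnP[m ->]|_]; last by rewrite mulr0 mul0rn.
case: k => [|k]; first by rewrite muln0 mul0r mulr0n.
by rewrite !mulnK // natrM mulrAC mulr_natr.
Qed.

Lemma derf_neg f : derf (neg f) = neg (derf f).
Proof. by apply: fpsP => n /=; rewrite mulrCA. Qed.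

Lemma fmul_reg f g : f 0%N = 1 -> f * g = 0 -> g = 0.
Proof.
move=> f0 fg0; apply: fpsP => n; elim/ltn_ind: n => n IHn.
have := congr1 (fun u : fps R => u n) fg0; rewrite coefMf big_ord_recl f0 mul1r.
rewrite subn0 big1 ?addr0 // => i _ /=; rewrite /bump /= IHn ?mulr0 //.
by have := ltn_ord i; lia.
Qed.

Lemma fmulI f g h : f 0%N = 1 -> f * g = f * h -> g = h.
Proof.
move=> f0 /eqP; rewrite -subr_eq0 -mulrBr => /eqP /(fmul_reg f0) /eqP.
by rewrite subr_eq0 => /eqP.
Qed.

(** Repeated division of a positive exponent by k ends at one that k does not divide, where the
    coefficient is 0. In [hasse_inv] and [weight4_sigma3] this turns invariance under q -> q^2 into
    constancy. *)
Lemma dil_fix k f : (1 < k)%N -> dil k f = f -> forall n, (0 < n)%N -> f n = 0.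
Proof.
move=> k1 fE; elim/ltn_ind => n IHn n0; rewrite -fE /=.
case: ifP => // /dvdnP[m nE]; rewrite nE mulnK //; last by lia.
by apply: IHn; rewrite ?nE; nia.
Qed.

End Operators.

HB.instance Definition _ (R : comNzRingType) k :=
  GRing.isZmodMorphism.Build (fps R) (fps R) (dil k.+1) (@dil_is_zmod_morphism R
    k.+1).
HB.instance Definition _ (R : comNzRingType) k :=
  GRing.isMonoidMorphism.Build (fps R) (fps R) (dil k.+1)
    (@dil_is_monoid_morphism R k.+1 (ltn0Sn k)).

Arguments fX {R}.

Section Morphisms.
Variable R : comNzRingType.
Implicit Types f g : fps R.

Lemma neg1 : neg 1 = 1 :> fps R. Proof. exact: rmorph1. Qed.
Lemma negD : {morph @neg R : f g / f + g}. Proof. exact: rmorphD. Qed.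
Lemma negB : {morph @neg R : f g / f - g}. Proof. exact: rmorphB. Qed.
Lemma negM : {morph @neg R : f g / f * g}. Proof. exact: rmorphM. Qed.
Lemma negX n : {morph @neg R : f / f ^+ n}. Proof. exact: rmorphXn. Qed.
Lemma neg_nat n : neg n%:R = n%:R :> fps R. Proof. exact: rmorph_nat. Qed.
Lemma neg_sign n : neg ((-1) ^+ n) = (-1) ^+ n :> fps R.
Proof. exact: rmorph_sign. Qed.

Variable k : nat.
Lemma dil1 : dil k.+1 1 = 1 :> fps R. Proof. exact: rmorph1. Qed.
Lemma dilD : {morph @dil R k.+1 : f g / f + g}. Proof. exact: rmorphD. Qed.
Lemma dilB : {morph @dil R k.+1 : f g / f - g}. Proof. exact: rmorphB. Qed.
Lemma dilM : {morph @dil R k.+1 : f g / f * g}. Proof. exact: rmorphM. Qed.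
Lemma dilX n : {morph @dil R k.+1 : f / f ^+ n}. Proof. exact: rmorphXn. Qed.
Lemma dil_nat n : dil k.+1 n%:R = n%:R :> fps R. Proof. exact: rmorph_nat. Qed.
Lemma dil_sign n : dil k.+1 ((-1) ^+ n) = (-1) ^+ n :> fps R.
Proof. exact: rmorph_sign. Qed.

Lemma derfD : {morph @derf R : f g / f + g}. Proof. exact: raddfD. Qed.
Lemma derfB : {morph @derf R : f g / f - g}. Proof. exact: raddfB. Qed.
End Morphisms.

Definition dilE := (dil1, dil_nat, dil_sign, dilD, dilB, dilX, dilM).

Local Close Scope ring_scope.

(** * The generating series of overpartitions *)

(* The flag b records that the part m has already occurred, so that it may no
   longer be overlined. *)
Fixpoint opart (m : nat) (b : bool) (s : seq (nat * bool)) : bool :=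
  if s is (k, c) :: s' then
    [&& 0 < k, k <= m, c ==> ~~ (b && (k == m)) & opart k true s']
  else true.

(** The list p holds the parts already read, which makes the overlining condition of
    [is_overpartition] recursive. *)
Definition first_overlined (p : seq nat) (s : seq (nat * bool)) :=
  all (fun i => (nth (0, false) s i).2 ==>
                (nth 0 (unzip1 s) i \notin p ++ take i (unzip1 s)))
      (iota 0 (size s)).

Lemma first_overlined_cons p k c s : first_overlined p ((k, c) :: s) =
  (c ==> (k \notin p)) && first_overlined (rcons p k) s.
Proof.
rewrite /first_overlined /= cats0; congr (_ && _).
rewrite (iotaDl 1 0) all_map; apply: eq_all => i /=.
by rewrite cat_rcons.
Qed.

(** The parts already read are at least m and those to come at most m, so only m itself can recur:
    one boolean carries all that is needed of p. *)
Lemma opartE s p m : all (leq m) p ->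
  opart m (m \in p) s =
  [&& path geq m (unzip1 s), 0 \notin unzip1 s & first_overlined p s].
Proof.
elim: s p m => [|[k c] s IHs] p m hp //.
rewrite first_overlined_cons /= inE negb_or (eq_sym 0) -lt0n.
case: (posnP k) => [->|k0]; first by rewrite !andbF.
case: (leqP k m) => [le_km|lt_mk] /=; last by rewrite ?andbF // leqNgt lt_mk.
have -> : (m \in p) && (k == m) = (k \in p).
  apply/andP/idP => [[mp /eqP->]//|kp].
  have := allP hp _ kp => le_mk.
  have <- : k = m by apply/eqP; rewrite eqn_leq le_km.
  by rewrite kp eqxx.
have {1}-> : true = (k \in rcons p k) by rewrite mem_rcons inE eqxx.
rewrite IHs; last first.
  rewrite all_rcons leqnn /=; apply: sub_all hp => j.
  exact: leq_trans.
by case: (c ==> _); rewrite // !andbF.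
Qed.

Lemma is_overpartitionE n s :
  is_overpartition n s = opart n false s && (sumn (unzip1 s) == n).
Proof.
rewrite (@opartE s [::] n) // /is_overpartition -/(first_overlined [::] s).
case: eqP => [<-|_]; last by rewrite !andbF.
rewrite !andbT andTb; congr (_ && _).
by case: s => //= -[k c] s /=; rewrite leq_addr.
Qed.

(* f is fuel: any f >= m + n gives the same list. *)
Fixpoint oparts (f m : nat) (b : bool) (n : nat) : seq (seq (nat * bool)) :=
  if n == 0 then [:: [::]] else
  if (f, m) is (f'.+1, m'.+1) then
    oparts f' m' false n ++
    (if m <= n then
       map (cons (m, false)) (oparts f' m true (n - m)) ++
       (if b then [::] else map (cons (m, true)) (oparts f' m true (n - m)))
     else [::])
  else [::].

Lemma mem_oparts f m b n s : m + n <= f ->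
  (s \in oparts f m b n) = opart m b s && (sumn (unzip1 s) == n).
Proof.
elim: f m b n s => [|f IHf] [|m] b n s /=.
- by case: n => // _; case: s => [|[[|k] c] s].
- by [].
- by case: n => [|n] _; case: s => [|[[|k] c] s].
rewrite addSn ltnS => hf.
case: eqP => [->|/eqP n0].
  case: s => [|[[|k] c] s] //; rewrite inE /= andbF //.
have mcat c : (s \in map (cons (m.+1, c)) (oparts f m.+1 true (n - m.+1))) && (m
  < n)
    = (if s is (k, c') :: s' then [&& k == m.+1, c' == c, opart m.+1 true s'
       & sumn (unzip1 s) == n] else false).
  case: s => [|[k c'] s].
    by apply/andP => -[/mapP[? _]].
  apply/andP/and4P => [[/mapP[s' hs' [-> -> ->]] lt_mn]|[/eqP kE /eqP-> hs
    /eqP]] /=.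
    move: hs'; rewrite IHf; last by lia.
    by case/andP=> -> /eqP->; rewrite subnKC.
  rewrite {}kE => nE; split; last by rewrite -nE leq_addr.
  by apply: map_f; rewrite IHf -nE ?hs ?addKn //=; lia.
rewrite mem_cat IHf //.
have {}mcat c : m < n ->
    (s \in map (cons (m.+1, c)) (oparts f m.+1 true (n - m.+1)))
    = (if s is (k, c') :: s' then [&& k == m.+1, c' == c, opart m.+1 true s'
       & sumn (unzip1 s) == n] else false).
  by move=> lt_mn; rewrite -mcat lt_mn andbT.
have -> : (s \in (if m < n
       then map (cons (m.+1, false)) (oparts f m.+1 true (n - m.+1)) ++
         (if b then [::] else map (cons (m.+1, true)) (oparts f m.+1 true (n -
           m.+1)))
       else [::])) = (if s is (k, c) :: s' then
   [&& k == m.+1, c ==> ~~ b, opart m.+1 true s' &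
     sumn (unzip1 s) == n] else false).
  case: ltnP => [lt_mn|le_nm].
    rewrite mem_cat mcat //.
    case: b; last first.
      rewrite mcat //; case: s {mcat} => [|[k [|]] s] //=.
        by rewrite andbF.
      by rewrite andbF orbF.
    by rewrite in_nil orbF; case: s {mcat} => [|[k [|]] s].
  rewrite in_nil; case: s {mcat} => [|[k c] s] //=.
  by apply/esym/negP => /and4P[/eqP-> _ _ /eqP]; lia.
case: s {mcat IHf} => [|[k c] s] //=; first by rewrite orbF.
rewrite (leq_eqVlt k m.+1) [k < m.+1]ltnS; case: (k =P m.+1) => [->|neq_k] /=.
  by rewrite ltnn /= andbT -!andbA.
by rewrite andbF implybT orbF.
Qed.

Lemma uniq_oparts f m b n : m + n <= f -> uniq (oparts f m b n).
Proof.
elim: f m b n => [|f IHf] [|m] b n; try by move=> _ /=; case: eqP.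
rewrite addSn ltnS /= => hf; case: eqP => // /eqP n0.
have inj c : injective (cons (m.+1, c : bool)) by move=> s t [].
have notin c s : (m.+1, c : bool) :: s \in oparts f m false n = false.
  by rewrite mem_oparts //= ltnn.
rewrite cat_uniq IHf //=; case: ltnP => //= lt_mn.
have un : uniq (oparts f m.+1 true (n - m.+1)) by apply: IHf; lia.
apply/andP; split.
  apply/hasPn => s; rewrite mem_cat => /orP[/mapP[s' _ ->]|];
    first by rewrite notin.
  by case: b => // /mapP[s' _ ->]; rewrite notin.
rewrite cat_uniq map_inj_uniq // un; case: b => //=.
rewrite map_inj_uniq // un andbT.
by apply/hasPn => s /mapP[s' _ ->]; apply/negP => /mapP[? _ []].
Qed.

Lemma size_oparts f g m b n : m + n <= f -> m + n <= g ->
  size (oparts f m b n) = size (oparts g m b n).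
Proof.
move=> hf hg; apply/perm_size/uniq_perm; try exact: uniq_oparts.
by move=> s; rewrite !mem_oparts.
Qed.

(** Either m + 1 does not occur or one copy of it is removed; a first occurrence counts twice, as it
    may be overlined. *)
Lemma size_opartsS m b n : size (oparts (m.+1 + n) m.+1 b n) =
  size (oparts (m + n) m false n) + (if m < n then
    (if b then 1 else 2) * size (oparts (m.+1 +
      (n - m.+1)) m.+1 true (n - m.+1))
  else 0).
Proof.
rewrite [in LHS]/=; case: eqP => [->|/eqP n0].
  by rewrite addn0; case: m.
rewrite size_cat; congr addn; case: ltnP => // lt_mn.
rewrite -(@size_oparts (m + n) (m.+1 + (n - m.+1))); try by lia.
by rewrite size_cat; case: b; rewrite !size_map ?addn0 ?mul1n // addnn mul2n.
Qed.

Lemma pbarE n : pbar n = size (oparts (n + n) n false n).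
Proof.
have un := @uniq_oparts (n + n) n false n (leqnn _).
rewrite /pbar cardE -(size_map (fun t : n.-bseq ('I_n.+1 * bool) =>
  erase_bound t)).
apply/perm_size/uniq_perm => //.
  rewrite map_inj_uniq ?enum_uniq // => s t /erase_bound_inj.
  exact: val_inj.
move=> s; rewrite mem_oparts // -is_overpartitionE.
apply/mapP/idP => [[t]|hs]; first by rewrite mem_enum inE => ? ->.
by have [t ht <-] := overpartition_bounded hs; exists t; rewrite ?mem_enum.
Qed.

Local Open Scope ring_scope.

Section OverpartitionSeries.
Variable R : comNzRingType.

(** For b = false this is the product of (1 + q^k)/(1 - q^k) over 1 <= k <= m. For b = true and m >
    0 the numerator 1 + q^m of the last factor is missing. *)
Definition opser (m : nat) (b : bool) : fps R :=
  Fps (fun n => (size (oparts (m + n) m b n))%:R).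

Lemma opser0 b : opser 0 b = 1.
Proof. by apply: fpsP => -[|n] //=; rewrite eqxx. Qed.

Lemma coef_opser m b n : opser m b n = (size (oparts (m + n) m b n))%:R.
Proof. by []. Qed.

Lemma opserS m b :
  opser m.+1 b = opser m false + (if b then 1 else 2%:R) * fX ^+ m.+1 * opser
    m.+1 true.
Proof.
apply: fpsP => n; rewrite coefDf.
have -> : ((if b then 1 else 2%:R) * fX ^+ m.+1 * opser m.+1 true) n =
   (if b then 1 else 2%:R) * (fX ^+ m.+1 * opser m.+1 true) n.
  by case: b; rewrite ?mul1r // -mulrA mulr_natl coefMnf mulr_natl.
rewrite coef_fXnM !coef_opser size_opartsS natrD ltnS; congr (_ + _).
case: leqP => _; first by rewrite mulr0.
by rewrite natrM; case: b.
Qed.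

Lemma opser_true m : (1 - fX ^+ m.+1) * opser m.+1 true = opser m false.
Proof. by rewrite mulrBl mul1r {1}opserS mul1r addrK. Qed.

Lemma opser_mul m : (1 + fX ^+ m.+1) * opser m.+1 true = opser m.+1 false.
Proof. by rewrite [RHS]opserS -opser_true; ring. Qed.

Lemma opser_false m :
  (1 - fX ^+ m.+1) * opser m.+1 false = (1 + fX ^+ m.+1) * opser m false.
Proof. by rewrite -opser_mul -opser_true; ring. Qed.

Lemma opser_pbar m n : (n <= m)%N -> opser m false n = (pbar n)%:R.
Proof.
move=> le_nm; rewrite pbarE /=; congr _%:R.
elim: m le_nm => [|m IHm]; first by case: n.
rewrite leq_eqVlt => /orP[/eqP->//|]; rewrite ltnS => le_nm.
rewrite -IHm //= ; case: eqP => [->|n0]; first by case: (m).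
by rewrite ltnNge le_nm /= cats0.
Qed.

Definition pbar_ser : fps R := Fps (fun n => (pbar n)%:R).

End OverpartitionSeries.

(** * Gauss's product for theta and the Landen transformation *)

Section Theta.
Variable R : comNzRingType.

Lemma eq_coefM (f g f' g' : fps R) n : (forall i, (i <= n)%N -> f i = f' i) ->
  (forall i, (i <= n)%N -> g i = g' i) -> (f * g) n = (f' * g') n.
Proof.
move=> hf hg; rewrite !coefMf; apply: eq_bigr => i _.
by have := ltn_ord i; rewrite ltnS => le_in; rewrite hf // hg // leq_subr.
Qed.

Lemma dil_fXn d k : dil d.+1 (fX ^+ k : fps R) = fX ^+ (d.+1 * k).
Proof.
apply: fpsP => n; rewrite coef_dil !coef_fXn.
case: ifP => [/dvdnP[m ->]|hn]; first by rewrite mulnK // mulnC eqn_pmul2l.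
by case: eqP => // nE; rewrite nE dvdn_mulr in hn.
Qed.

(** The sum of (-1)^k q^(k^2) over |k| <= N, so that [theta4] is w = phi(-q) and [theta3] below is
    phi(q). *)
Definition theta4_part N : fps R :=
  1 + 2%:R * \sum_(k < N) (-1) ^+ k.+1 * fX ^+ (k.+1 ^ 2).

Definition theta4 : fps R := Fps (fun n => theta4_part n n).

Lemma theta4_partS N : theta4_part N.+1 =
  theta4_part N + 2%:R * ((-1) ^+ N.+1 * fX ^+ (N.+1 ^ 2)).
Proof. by rewrite /theta4_part big_ord_recr /=; ring. Qed.

Lemma coef_signM k (f : fps R) n : ((-1) ^+ k * f) n = (-1) ^+ k * f n.
Proof.
rewrite -signr_odd -[in RHS]signr_odd.
by case: (odd k); rewrite ?expr1 ?expr0 ?mulN1r ?mul1r.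
Qed.

Lemma coef_theta4_part N n : (n <= N)%N -> theta4_part N n = theta4 n.
Proof.
elim: N => [|N IHN]; first by case: n.
rewrite leq_eqVlt => /orP[/eqP->//|]; rewrite ltnS => le_nN.
rewrite theta4_partS coefDf IHN // mulr_natl coefMnf coef_signM coef_fXn.
by case: eqP => [nE|]; [nia | rewrite mulr0 mul0rn addr0].
Qed.

(** A q-difference equation relating the values at Q and q Q of a basic hypergeometric sum truncated
    at m; the last term is the truncation error. At Q = q^(n+1) it drives the induction below, where
    this error and the last summand together produce the new term of [theta4_part]. *)
Lemma gauss_telescope (Q : fps R) m :
  (1 - Q) * (1 + 2%:R * \sum_(s < m)
     (-1) ^+ s.+1 * (fX * Q) ^+ s.+1 * opser R s.+1 true) =
  (1 + Q) * (1 + 2%:R * \sum_(s < m) (-1) ^+ s.+1 * Q ^+ s.+1 * opser R s.+1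
    true)
  + 2%:R * (-1) ^+ m.+1 * Q ^+ m.+1 * opser R m false.
Proof.
elim: m => [|m IHm]; first by rewrite !big_ord0 opser0; ring.
rewrite !big_ord_recr /=; set S1 := \sum_(i < m) _ in IHm *.
set S2 := \sum_(i < m) _ in IHm *.
rewrite (mulrDr 2%:R S1) (addrA 1) (mulrDr (1 - Q)) IHm exprMn.
rewrite -opser_true -[opser R m.+1 false]opser_mul.
rewrite [Q ^+ m.+2]exprS [(-1) ^+ m.+2]exprS.
by ring.
Qed.

Lemma coef0_fXnS n : (fX ^+ n.+1 : fps R) 0%N = 0.
Proof. by rewrite coef_fXn. Qed.

Lemma coef0_1B n : (1 - fX ^+ n.+1 : fps R) 0%N = 1.
Proof. by rewrite coefBf coef0_fXnS subr0 coef1f. Qed.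

Lemma coef0_1D n : (1 + fX ^+ n.+1 : fps R) 0%N = 1.
Proof. by rewrite coefDf coef0_fXnS addr0 coef1f. Qed.

(* A finite form of Gauss's identity: the right-hand side is 1 + O(q^(n+1)). *)
Lemma opser_theta4_part n : opser R n false * theta4_part n =
  1 + 2%:R * \sum_(s < n)
     (-1) ^+ s.+1 * (fX ^+ n.+1) ^+ s.+1 * opser R s.+1 true.
Proof.
elim: n => [|n IHn].
  by rewrite /theta4_part !big_ord0 opser0; ring.
apply: (fmulI (coef0_1B n)).
rewrite mulrA opser_false theta4_partS [fX ^+ n.+2]exprS.
rewrite big_ord_recr /= (mulrDr 2%:R) addrA (mulrDr (1 - _)) gauss_telescope
  -IHn.
rewrite exprMn -opser_true -mulnn (exprM fX n.+1 n.+1).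
by ring.
Qed.

Lemma pbar_theta4 : pbar_ser R * theta4 = 1.
Proof.
apply: fpsP => n.
rewrite -(@eq_coefM (opser R n false) (theta4_part n)).
- rewrite opser_theta4_part coefDf mulr_natl coefMnf coef_sumf.
  rewrite big1 ?mul0rn ?addr0 // => s _.
  rewrite -mulrA coef_signM -exprM coef_fXnM.
  by case: ifP => [_|]; [rewrite mulr0 | nia].
- by move=> i le_in; rewrite opser_pbar.
by move=> i le_in; rewrite coef_theta4_part.
Qed.

(* k q^k / (1 - q^(2k)) *)
Definition lambert_term k : fps R :=
  Fps (fun n => if (k %| n)%N && odd (n %/ k) then k%:R else 0).

Lemma lambert_termE k : (0 < k)%N ->
  (1 - fX ^+ k * fX ^+ k) * lambert_term k = k%:R * fX ^+ k.
Proof.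
move=> k0; apply: fpsP => n.
rewrite mulrBl mul1r -exprD coefBf coef_fXnM mulr_natl coefMnf coef_fXn /=.
case: ltnP => [lt_n|le_n].
  case: (boolP (k %| n)%N) => [/dvdnP[m nE]|ndv].
    subst n; have {lt_n}: (m < 2)%N by nia.
    rewrite mulnK // subr0; case: m => [|[|//]] _; rewrite ?mul0n ?mul1n /=.
      by rewrite eq_sym (gtn_eqF k0) mul0rn.
    by rewrite eqxx.
  by rewrite subr0; case: eqP ndv => [->|]; rewrite ?dvdnn // mul0rn.
have -> : (n == k) = false by apply/eqP; lia.
have [m nE] : exists m, n = (m + (k + k))%N by exists (n - (k + k))%N; lia.
rewrite nE addnK dvdn_addl ?dvdn_add // mul0rn.
rewrite divnDr ?dvdn_add // -{3 4}(mul1n k) -mulnDl mulnK // oddD addbF subrr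
  //.
Qed.

Definition lambert_part N : fps R := \sum_(k < N) lambert_term k.+1.

(** Logarithmic differentiation: the factor (1 + q^k)/(1 - q^k) contributes 2 k q^k/(1 - q^(2k)).
    Denominators are cleared by cancelling series with constant term 1. *)
Lemma derf_opser m :
  derf (opser R m false) = 2%:R * opser R m false * lambert_part m.
Proof.
rewrite /lambert_part; elim: m => [|m IHm].
  by rewrite opser0 derf1 big_ord0 mulr0.
have h0 := opser_false R m; have h1 := congr1 (@derf R) h0.
have hl := lambert_termE (ltn0Sn m).
apply: (fmulI (coef0_1D m)); apply: (fmulI (coef0_1B m)).
rewrite !derfM raddfB raddfD /= derf1 derf_fX IHm in h1.
rewrite big_ord_recr /=.
move: h0 h1 hl {IHm}; set X := fX ^+ _; set A := opser R m _;
  set A' := opser _ _ _.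
set S := \sum_(i < m) _; set l := lambert_term _; set k := m.+1%:R.
move=> h0 h1 hl.
have -> : (1 - X) * ((1 + X) * derf A') = (1 + X) * ((0 - k * X) * A' +
  (1 - X) * derf A')
  + (1 + X) * k * X * A' by ring.
rewrite h1.
have -> : (1 - X) * ((1 + X) * (2%:R * A' * (S + l))) =
  2%:R * (1 + X) * S * ((1 - X) * A') + 2%:R * A' * ((1 - X * X) * l) by ring.
rewrite hl h0.
have -> : (1 + X) * ((0 + k * X) * A + (1 + X) * (2%:R * A * S)) =
  k * X * ((1 + X) * A) + 2%:R * (1 + X) * S * ((1 + X) * A) by ring.
by rewrite -h0; ring.
Qed.

Definition lambert : fps R := Fps (fun n => lambert_part n n).

Lemma coef_lambert n :
  lambert n = \sum_(k < n | (k.+1 %| n)%N && odd (n %/ k.+1)) k.+1%:R.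
Proof. by rewrite /lambert /= coef_sumf [RHS]big_mkcond. Qed.

Lemma coef_lambert_part N n : (n <= N)%N -> lambert_part N n = lambert n.
Proof.
elim: N => [|N IHN]; first by case: n.
rewrite leq_eqVlt => /orP[/eqP->//|]; rewrite ltnS => le_nN.
rewrite /lambert_part big_ord_recr coefDf -/(lambert_part N) IHN //=.
case: ifP => [/andP[dv]|_]; last by rewrite addr0.
have [->|n0] := posnP n; first by rewrite div0n.
by have := dvdn_leq n0 dv; lia.
Qed.

Lemma derf_pbar_ser : derf (pbar_ser R) = 2%:R * pbar_ser R * lambert.
Proof.
apply: fpsP => n.
have -> : derf (pbar_ser R) n = derf (opser R n false) n.
  by rewrite !coef_derf opser_pbar.
rewrite derf_opser -!mulrA !(mulr_natl _ 2) !coefMnf; congr (_ *+ 2).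
apply: eq_coefM => i le_in; first by rewrite opser_pbar.
by rewrite coef_lambert_part.
Qed.

Lemma neg_fXn k : neg (fX ^+ k : fps R) = (-1) ^+ k * fX ^+ k.
Proof.
apply: fpsP => n; rewrite coef_neg coef_signM coef_fXn.
by case: eqP => [->//|_]; rewrite !mulr0.
Qed.

Lemma neg_opser_false m :
  (1 - (-1) ^+ m.+1 * fX ^+ m.+1) * neg (opser R m.+1 false) =
  (1 + (-1) ^+ m.+1 * fX ^+ m.+1) * neg (opser R m false).
Proof.
have := congr1 (@neg R) (opser_false R m).
by rewrite !negM negB negD !neg1 neg_fXn.
Qed.

(** Under q -> -q the factors of odd index are inverted and cancel, while those of even index are
    squared. *)
Lemma opser_neg m : opser R m.*2 false * neg (opser R m.*2 false) =
  dil 2 (opser R m false) ^+ 2.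
Proof.
elim: m => [|m IHm]; first by rewrite opser0 neg1 dil1; ring.
have h1 := opser_false R m.*2; have h2 := opser_false R m.*2.+1.
have h3 := neg_opser_false m.*2; have h4 := neg_opser_false m.*2.+1.
have h5 := congr1 (dil 2) (opser_false R m).
rewrite !dilM dilB dilD !dil1 dil_fXn in h5.
have dE : (2 * m.+1 = m.*2.+2)%N by rewrite mul2n doubleS.
rewrite dE in h5; rewrite doubleS.
have s1 : (-1) ^+ m.*2.+1 = -1 :> fps R.
  by rewrite -signr_odd /= odd_double expr1.
have s2 : (-1) ^+ m.*2.+2 = 1 :> fps R.
  by rewrite -signr_odd /= odd_double expr0.
rewrite s1 in h3; rewrite s2 mul1r in h4.
apply: (fmulI (coef0_1B m.*2.+1)); apply: (fmulI (coef0_1B m.*2.+1)).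
apply: (fmulI (coef0_1B m.*2)); apply: (fmulI (coef0_1D m.*2)).
move: h1 h2 h3 h4 h5 IHm; set X1 := fX ^+ _; set X2 := fX ^+ _.
set A0 := opser R m.*2 _; set A1 := opser R _.+1 _; set A2 := opser R _.+2 _.
set B1 := dil 2 _; set B0 := dil 2 _ => h1 h2 h3 h4 h5 IHm.
have -> : (1 + X1) * ((1 - X1) * ((1 - X2) * ((1 - X2) * (A2 * neg A2)))) =
  (1 + X1) * (1 - X1) * (((1 - X2) * A2) * ((1 - X2) * neg A2)) by ring.
rewrite h2 h4.
have -> : (1 + X1) * (1 - X1) * ((1 + X2) * A1 * ((1 + X2) * neg A1)) =
  (1 + X2) ^+ 2 * (((1 - X1) * A1) * ((1 - -1 * X1) * neg A1)) by ring.
rewrite h1 h3.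
have -> : (1 + X1) * ((1 - X1) * ((1 - X2) * ((1 - X2) * (B1 ^+ 2)))) =
  (1 + X1) * (1 - X1) * ((1 - X2) * B1) ^+ 2 by ring.
rewrite h5 [(_ * B0) ^+ 2]exprMn -IHm; ring.
Qed.

Lemma pbar_ser_neg : pbar_ser R * neg (pbar_ser R) = dil 2 (pbar_ser R) ^+ 2.
Proof.
apply: fpsP => n.
have agree i : (i <= n)%N -> pbar_ser R i = opser R n.*2 false i.
  by move=> le_in; rewrite opser_pbar //; lia.
rewrite expr2 (@eq_coefM _ _ (opser R n.*2 false) (neg (opser R n.*2 false)))
  //.
- rewrite opser_neg expr2; apply: eq_coefM => i le_in; rewrite !coef_dil;
    by case: ifP => // _; rewrite opser_pbar // (leq_trans (leq_div _ _)).
- by move=> i le_in; rewrite !coef_neg agree.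
Qed.

Definition theta3 : fps R := neg theta4.

(** Gauss's identity inverts the three factors of [pbar_ser_neg]. *)
Lemma theta34 : theta4 * theta3 = dil 2 theta4 ^+ 2.
Proof.
have h := pbar_theta4; have hn := congr1 (@neg R) h;
  have hd := congr1 (dil 2) h.
rewrite negM neg1 -/theta3 in hn; rewrite dilM dil1 in hd.
have hs := pbar_ser_neg; move: h hn hd hs.
set p := pbar_ser R; set np := neg p; set dp := dil 2 p; set dw := dil 2 theta4.
move=> h hn hd hs.
have -> : theta4 * theta3 = theta4 * theta3 * (dp * dw) ^+ 2 by rewrite hd;
  ring.
rewrite exprMn -hs.
have -> : theta4 * theta3 * (p * np * dw ^+ 2) =
  (p * theta4) * (np * theta3) * dw ^+ 2 by ring.
by rewrite h hn; ring.
Qed.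

(** The terms with k odd cancel, and k = 2j gives the exponent 4 j^2; in the limit phi(q) + phi(-q)
    = 2 phi(q^4). *)
Lemma theta4_part_sum N : theta4_part N.*2 + neg (theta4_part N.*2) =
  2%:R * dil 4 (neg (theta4_part N)).
Proof.
elim: N => [|N IHN].
  by rewrite /theta4_part !big_ord0 mulr0 addr0 !neg1 dil1; ring.
move: IHN; rewrite doubleS !theta4_partS.
move: (theta4_part N.*2) (theta4_part N) => P P' IHN.
rewrite !(neg_nat, neg_sign, neg_fXn, negD, negM).
rewrite !(dil_nat, dil_sign, dil_fXn, dilD, dilM).
rewrite [RHS]mulrDr -IHN.
have sgn n : (-1) ^+ n = (if odd n then -1 else 1) :> fps R.
  by rewrite -signr_odd; case: (odd n); rewrite ?expr1 ?expr0.
have -> : (4 * N.+1 ^ 2 = N.*2.+2 ^ 2)%N by rewrite -doubleS -mul2n expnMn.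
rewrite !sgn !oddX /= odd_double /=.
move: (fX ^+ _) (fX ^+ _) => X Y.
by case: (odd N) => /=; ring.
Qed.

Lemma theta34_sum : theta4 + theta3 = 2%:R * dil 4 theta3.
Proof.
apply: fpsP => n.
have le_n : (n <= n.*2)%N by lia.
rewrite coefDf /theta3 coef_neg -(coef_theta4_part le_n) -coef_neg -coefDf.
rewrite theta4_part_sum !mulr_natl !coefMnf !coef_dil; case: ifP => // _.
by rewrite !coef_neg (coef_theta4_part (leq_div _ _)).
Qed.

Lemma dil_comp k l (f : fps R) : (0 < k)%N -> (0 < l)%N ->
  dil k (dil l f) = dil (k * l) f.
Proof.
move=> k0 l0; apply: fpsP => n; rewrite !coef_dil.
have [/dvdnP[m ->]|ndv] := boolP (k %| n)%N; last first.
  by rewrite ifN //; apply: contra ndv; apply: dvdn_trans; apply: dvdn_mulr.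
by rewrite mulnK // (mulnC m) dvdn_pmul2l // divnMl.
Qed.

(** For n > 0 the coefficient of q^n on the right involves f only at exponents at most n/k < n. *)
Lemma dil_eigen_eq0 k (c f : fps R) : (1 < k)%N -> f 0%N = 0 ->
  f = c * dil k f -> f = 0.
Proof.
move=> k1 f0 fE; apply: fpsP => n; elim/ltn_ind: n => n IHn.
have [->//|n0] := posnP n; rewrite fE coefMf big1 // => i _.
rewrite coef_dil; case: ifP => [dv|_]; last by rewrite mulr0.
rewrite IHn ?mulr0 //; apply: leq_ltn_trans (ltn_Pdiv k1 n0).
by apply: leq_div2r; apply: leq_subr.
Qed.

Lemma coef0_theta4 : theta4 0%N = 1.
Proof. by rewrite /= /theta4_part big_ord0 mulr0 addr0. Qed.

Lemma coef0_theta3 : theta3 0%N = 1.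
Proof. by rewrite coef_neg coef0_theta4 mulr1. Qed.

(* By theta34 and theta34_sum the defect d satisfies d(q) = -2 d(q^2). *)
Lemma theta34_sqr : theta3 ^+ 2 + theta4 ^+ 2 = 2%:R * dil 2 theta3 ^+ 2.
Proof.
apply/eqP; rewrite -subr_eq0; apply/eqP.
apply: (@dil_eigen_eq0 2 (- 2%:R)) => //.
  rewrite mulr_natl coefBf coefDf coefMnf !coef_exp0 coef_dil dvdn0 div0n.
  by rewrite coef0_theta3 coef0_theta4 !expr1n subrr.
have h2 := theta34; have h4 := theta34_sum.
rewrite !(dilB, dilD, dilM, dilX, dil_nat) dil_comp //.
rewrite -[(2 * 2)%N]/4%N.
have -> : theta3 ^+ 2 + theta4 ^+ 2 = (theta4 +
  theta3) ^+ 2 - 2%:R * (theta4 * theta3) by ring.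
by rewrite h2 h4; ring.
Qed.

End Theta.

Lemma coef_mul1 (R : comNzRingType) (f g : fps R) :
  (f * g) 1%N = f 0%N * g 1%N + f 1%N * g 0%N.
Proof. by rewrite coefMf !big_ord_recr big_ord0 /= add0r. Qed.

Lemma coef_natM (R : comNzRingType) k (f : fps R) n : (k%:R * f) n = k%:R * f n.
Proof. by rewrite mulr_natl coefMnf mulr_natl. Qed.

Lemma coef0_dil (R : comNzRingType) k (f : fps R) : dil k f 0%N = f 0%N.
Proof. by rewrite coef_dil dvdn0 div0n. Qed.

(** * The differential equation of the theta functions *)

Section ThetaEquation.
Local Notation F := 'F_11.
Local Notation w := (theta4 F).
Local Notation t := (theta3 F).
Local Notation L := (lambert F).
Local Notation xs := (w ^+ 4).
Local Notation zs := (t ^+ 4).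
Local Notation ys := (t ^+ 4 - w ^+ 4).
(** Here a = phi(q^2)^2 and b = (phi(q)^2 - phi(-q)^2)/2 parametrize the Landen transformation: z,
    x, y are (a + b)^2, (a - b)^2, 4 a b, while z(q^2) and y(q^2) are a^2 and b^2. *)
Local Notation a := (dil 2 t ^+ 2).
Local Notation b := (dil 2 t ^+ 2 - w ^+ 2).

Lemma theta3_sqr : t ^+ 2 = a + b.
Proof.
have h := theta34_sqr F.
have -> : t ^+ 2 = 2%:R * a - w ^+ 2 by rewrite -h; ring.
by ring.
Qed.

Lemma theta4_sqr : w ^+ 2 = a - b. Proof. by ring. Qed.

Lemma zsE : zs = (a + b) ^+ 2. Proof. by rewrite -theta3_sqr -exprM. Qed.
Lemma xsE : xs = (a - b) ^+ 2. Proof. by rewrite -theta4_sqr -exprM. Qed.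
Lemma ysE : ys = 4%:R * a * b.
Proof. by rewrite [zs]zsE [xs]xsE; ring. Qed.

Lemma dil_zs : dil 2 zs = a ^+ 2. Proof. by rewrite dilX -exprM. Qed.
Lemma dil_xs : dil 2 xs = a ^+ 2 - b ^+ 2.
Proof.
rewrite dilX (exprM _ 2 2) -theta34 exprMn theta3_sqr.
by rewrite [w ^+ 2]theta4_sqr; ring.
Qed.
Lemma dil_ys : dil 2 ys = b ^+ 2.
Proof. by rewrite dilB dil_zs dil_xs; ring. Qed.

Lemma coef1_theta4 : w 1%N = - 2%:R.
Proof.
rewrite -(coef_theta4_part _ (leqnn 1)) /theta4_part big_ord1 coefDf coef1f
  add0r coef_natM.
by rewrite coef_signM coef_fXn; apply/eqP.
Qed.

Lemma coef1_b : b 1%N = 4%:R.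
Proof.
rewrite coefBf !expr2 !coef_mul1 coef0_dil.
have -> : dil 2 t 1%N = 0 by [].
by rewrite coef0_theta3 coef0_theta4 coef1_theta4; apply/eqP.
Qed.

Lemma coef0_a : a 0%N = 1.
Proof. by rewrite coef_exp0 coef0_dil coef0_theta3 expr1n. Qed.

Lemma coef0_b : b 0%N = 0.
Proof. by rewrite coefBf coef0_a coef_exp0 coef0_theta4 expr1n subrr. Qed.

Lemma coef0_xs : xs 0%N = 1. Proof. by rewrite coef_exp0 coef0_theta4 expr1n.
  Qed.
Lemma coef0_zs : zs 0%N = 1. Proof. by rewrite coef_exp0 coef0_theta3 expr1n.
  Qed.
Lemma coef0_ys : ys 0%N = 0. Proof. by rewrite coefBf coef0_zs coef0_xs subrr.
  Qed.


Lemma nat11_fps : 11%:R = 0 :> fps F.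
Proof.
by apply: fpsP => n; rewrite -[11%:R]mulr1 coef_natM; apply/eqP;
  rewrite mulf_eq0.
Qed.

(** After substitution both sides are the same polynomial in A, B, [derf A] and [derf B].
    Differentiating a series in q^2 produces a factor 2, cancelled with its inverse 6 mod 11. *)
Lemma ode_doubling (x y z A B : fps F) :
  z = (A + B) ^+ 2 -> y = 4%:R * A * B -> x = (A - B) ^+ 2 ->
  dil 2 z = A ^+ 2 -> dil 2 y = B ^+ 2 -> dil 2 x = A ^+ 2 - B ^+ 2 ->
  A * B * (z * derf y - y * derf z - x * y * z) =
  4%:R * (A ^+ 2 - B ^+ 2) * dil 2 (z * derf y - y * derf z - x * y * z).
Proof.
move=> zE yE xE dz dy dx.
have dDz := congr1 (@derf F) dz; have dDy := congr1 (@derf F) dy.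
rewrite derf_dil derfX expr1 in dDz; rewrite derf_dil derfX expr1 in dDy.
have half (f g : fps F) : 2%:R * f = 2%:R * g -> f = g.
  move=> h; have -> : f = 6%:R * (2%:R * f) - 11%:R * f by ring.
  by rewrite h nat11_fps mul0r subr0 mulrA -natrM -[(6 * 2)%N]/(1 +
    11)%N natrD nat11_fps addr0 mul1r.
have {}dDz : dil 2 (derf z) = A * derf A by apply: half; rewrite dDz mulrA.
have {}dDy : dil 2 (derf y) = B * derf B by apply: half; rewrite dDy mulrA.
rewrite !(dilB, dilM) dz dy dx dDz dDy zE yE xE.
rewrite derfX expr1 !derfM derfD.
have -> : derf (4%:R : fps F) = 0.
  by rewrite -[4%:R]mulr1 mulr_natl raddfMn /= derf1 mul0rn.
by ring.
Qed.

(* D log(y/z) = x. The defect N satisfies a b N(q) = 4 (a^2 - b^2) N(q^2) with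
   a b of valuation 1, so N vanishes as soon as its first two coefficients do.
     *)
Lemma theta_ode : zs * derf ys - ys * derf zs = xs * ys * zs.
Proof.
have := ode_doubling zsE ysE xsE dil_zs dil_ys dil_xs.
set N := _ - xs * ys * zs => hN.
suff N0 : N = 0 by apply/eqP; rewrite -subr_eq0 -/N N0.
have N_0 : N 0%N = 0.
  by rewrite /N !coefBf !coef_mul0 !coef_derf coef0_ys !mul0r !mulr0 mul0r
    !subr0.
have N_1 : N 1%N = 0.
  rewrite /N; move: coef0_ys coef0_zs coef0_xs.
  move: (ys) => y; move: (xs) (zs) => x z y0 z0 x0.
  rewrite (coefBf (_ - _)) (coefBf (z * _)) !coef_mul1 !coef_mul0 !coef_derf.
  by rewrite y0 z0 x0; ring.
have ab0 : (a * b) 0%N = 0 by rewrite coef_mul0 coef0_b mulr0.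
have ab1 : (a * b) 1%N = 4%:R by rewrite coef_mul1 coef0_b coef1_b coef0_a mulr0
  mul1r addr0.
apply: fpsP => n; elim/ltn_ind: n => -[|[|n]] // IHn.
(* Since a b starts with 4 q, the coefficient of N at n + 2 appears at exponent n + 3; on the right
   N is needed only up to (n + 3)/2 < n + 2. *)
have hn : (a * b * N) n.+3 = _ := congr1 (fun f : fps F => f n.+3) hN.
move: hn; rewrite -(mulrA 4%:R) coef_natM [X in _ = _ * X]coefMf big1;
  last first.
  move=> i _; rewrite coef_dil; case: ifP => _; last by rewrite mulr0.
  rewrite IHn ?mulr0 // ltn_divLR //.
  by have := ltn_ord i; lia.
rewrite coefMf 2!big_ord_recl ab0 mul0r add0r ab1 big1; last first.
  by move=> i _; rewrite IHn ?mulr0 // /= /bump; lia.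
rewrite mulr0 addr0 lift0 subSS subn0 => /eqP;
  rewrite mulf_eq0 => /orP[/eqP|/eqP] //.
Qed.

Lemma derf_theta4 : derf w = - (2%:R * L * w).
Proof.
have h := pbar_theta4 F; have := congr1 (@derf F) h.
rewrite derfM derf1 derf_pbar_ser => hD.
have -> : derf w = (pbar_ser F * w) * derf w by rewrite h mul1r.
have -> : pbar_ser F * w * derf w = w * (2%:R * pbar_ser F * L * w +
  pbar_ser F * derf w)
  - 2%:R * L * w * (pbar_ser F * w) by ring.
by rewrite hD h; ring.
Qed.

Lemma derf_theta3 : derf t = - (2%:R * neg L * t).
Proof.
rewrite /theta3 derf_neg derf_theta4 -[LHS]/(neg _) -(sub0r (_ * w)) negB.
by rewrite !negM neg_nat raddf0 sub0r.
Qed.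

(** As y = z - x, the differential equation also reads D log(z/x) = y, and the logarithmic
    derivatives of w and phi(q) are Lambert series. *)
Lemma ys_lambert : ys = 8%:R * (L - neg L).
Proof.
have h := theta_ode.
rewrite derfB !derfX derf_theta3 derf_theta4 /= in h.
apply: (fmulI coef0_xs); apply: (fmulI coef0_zs).
have -> : zs * (xs * ys) = xs * ys * zs by ring.
by rewrite -h; ring.
Qed.

Lemma coef_ys n : ys n = if odd n then 16%:R * L n else 0.
Proof.
rewrite ys_lambert coef_natM coefBf coef_neg -signr_odd.
by case: (odd n); rewrite ?expr1 ?expr0; ring.
Qed.
End ThetaEquation.

(** * Extraction of the exponents divisible by 11 *)

Section CoefMul11.
Local Notation F := 'F_11.
Local Notation w := (theta4 F).
Local Notation t := (theta3 F).
Local Notation L := (lambert F).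
Local Notation xs := (w ^+ 4).
Local Notation zs := (t ^+ 4).
Local Notation ys := (t ^+ 4 - w ^+ 4).

(** Divisors that are multiples of 11 vanish in the field; the others divide n already, and the
    factor 11 does not change the parity of the cofactor. *)
Lemma coef_lambert11 n : L (11 * n)%N = L n.
Proof.
rewrite !coef_lambert (big_ord_widen_cond (11 * n) (fun k =>
  (k.+1 %| n)%N && odd (n %/ k.+1))
  (fun k => k.+1%:R)); last by rewrite leq_pmull.
have null (P : pred 'I_(11 * n)) : \sum_(k | P k && (11 %| k.+1)%N) k.+1%:R =
  0 :> F.
  rewrite big1 // => k /andP[_ /dvdnP[m ->]].
  by rewrite natrM; apply/eqP; rewrite mulf_eq0 orbT.
rewrite [LHS](bigID (fun k : 'I_(11 * n) => (11 %| k.+1)%N)) null.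
rewrite [RHS](bigID (fun k : 'I_(11 * n) => (11 %| k.+1)%N)) null /=.
congr (_ + _); apply: eq_bigl => k; case: (boolP (11 %| k.+1)%N) => ndv.
  by rewrite !andbF.
have cop : coprime k.+1 11 by rewrite coprime_sym prime_coprime.
rewrite !andbT Gauss_dvdr //; case: (boolP (k.+1 %| n)%N) => //= dv.
rewrite -muln_divA // oddM /=.
have n0 : (0 < n)%N.
  by have := leq_ltn_trans (leq0n k) (ltn_ord k); rewrite muln_gt0.
by rewrite (dvdn_leq n0 dv) andbT.
Qed.

(** This gives z at n from y at n and from z and y at n/2, and so carries the invariance under n ->
    11 n from y over to z. *)
Lemma zs_doubling : 2%:R * zs = ys + 2%:R * dil 2 (zs + ys).
Proof.
rewrite dilD dil_ys dil_zs.
have -> : 2%:R * zs = ys + (zs + xs) by ring.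
by rewrite zsE xsE; ring.
Qed.

Lemma coef_ys11 n : ys (11 * n)%N = ys n.
Proof. by rewrite !coef_ys oddM coef_lambert11. Qed.

Lemma coef_zs11 n : zs (11 * n)%N = zs n.
Proof.
elim/ltn_ind: n => n IHn; have [->|n0] := posnP n; first by rewrite muln0.
have h m : 2%:R * zs m = ys m + 2%:R * dil 2 (zs + ys) m.
  by rewrite -!coef_natM -coefDf -zs_doubling.
apply: (@mulfI _ 2%:R) => //; rewrite !h coef_ys11; congr (_ + _ * _).
rewrite !coef_dil Gauss_dvdr //; case: ifP => // dv.
by rewrite -muln_divA // !(coefDf zs ys) coef_ys11 IHn // ltn_Pdiv.
Qed.

Lemma coef_xs11 n : xs (11 * n)%N = xs n.
Proof.
have xsB m : xs m = zs m - ys m.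
  by rewrite -(coefBf zs ys); congr (coef _ m); ring.
by rewrite !xsB coef_zs11 coef_ys11.
Qed.

(* E is E_10 mod 11, with coefficients binomial(5, i)^2. In the proof, the two
   sides differ by 11 times the polynomial multiplied by 0. *)
Lemma hasse_landen (a b : fps F) :
  let E z y := z ^+ 5 + 3%:R * z ^+ 4 * y + z ^+ 3 * y ^+ 2 + z ^+ 2 * y ^+ 3
    + 3%:R * z * y ^+ 4 + y ^+ 5 in
  E ((a + b) ^+ 2) (4%:R * a * b) = E (a ^+ 2) (b ^+ 2).
Proof.
move=> E; rewrite -[RHS]addr0 -(mul0r (2%:R * a ^+ 9 * b ^+ 1 +
  14%:R * a ^+ 8 * b ^+ 2 + 56%:R * a ^+ 7 * b ^+ 3 +
  195%:R * a ^+ 6 * b ^+ 4 + 396%:R * a ^+ 5 * b ^+ 5 +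
  195%:R * a ^+ 4 * b ^+ 6 + 56%:R * a ^+ 3 * b ^+ 7 +
  14%:R * a ^+ 2 * b ^+ 8 + 2%:R * a ^+ 1 * b ^+ 9)) -nat11_fps /E.
by ring.
Qed.

(** By [hasse_landen] the left-hand side is invariant under q -> q^2, hence equal to its constant
    term. *)
Lemma hasse_inv :
  zs ^+ 5 + 3%:R * zs ^+ 4 * ys + zs ^+ 3 * ys ^+ 2 + zs ^+ 2 * ys ^+ 3
    + 3%:R * zs * ys ^+ 4 + ys ^+ 5 = 1.
Proof.
set e := (X in X = 1).
have e0 : e 0%N = 1.
  rewrite /e; move: coef0_ys coef0_zs; move: (zs) (ys) => z y y0 z0.
  rewrite !(coef_exp0, coefDf, coef_mul0) y0 z0.
  by rewrite !expr0n /= !mulr0 !addr0 expr1n.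
suff he : dil 2 e = e.
  apply: fpsP => n; rewrite coef1f; case: n => [//|n].
  exact: dil_fix he _ _.
rewrite /e; move: dil_zs dil_ys zsE ysE; move: (zs) (ys) => z y dz dy zE yE.
rewrite !dilE -/(dil 2) dz dy zE yE; exact/esym/hasse_landen.
Qed.
End CoefMul11.

(** * The generating series of pbar(11 n) modulo 11 *)

Section Atkin.
Local Notation F := 'F_11.
Local Notation w := (theta4 F).
Local Notation t := (theta3 F).
Local Notation pb := (pbar_ser F).
Local Notation xs := (w ^+ 4).
Local Notation zs := (t ^+ 4).
Local Notation ys := (t ^+ 4 - w ^+ 4).

Lemma frobenius_poly (p : {poly F}) : p ^+ 11 = p \Po 'X^11.
Proof.
have char : 11%N \in [pchar {poly F}] by rewrite pchar_poly pchar_Fp.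
rewrite -(pFrobenius_autE char) -{1}[p]coefK poly_def rmorph_sum /=.
rewrite comp_polyE; apply: eq_bigr => i _.
rewrite pFrobenius_autE exprZn -exprM mulnC exprM; congr (_ *: _).
by rewrite -{1}[p`_i]natr_Zp -(pFrobenius_autE (pchar_Fp _)) //
  pFrobenius_aut_nat natr_Zp.
Qed.

Lemma coef_trunc_exp N (f : fps F) k i : (i < N)%N -> (trunc N f ^+ k)`_i =
  (f ^+ k) i.
Proof.
elim: k i => [|k IHk] i lt_iN; first by rewrite !expr0 coef1.
rewrite !exprS; apply: (coef_fmul lt_iN) => j lt_j; last exact: IHk.
exact: coef_trunc.
Qed.

Lemma frobenius_fps (g : fps F) : g ^+ 11 = dil 11 g.
Proof.
apply: fpsP => n; rewrite -(coef_trunc_exp g 11 (ltnSn n)) frobenius_poly.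
rewrite coef_comp_poly_Xn // coef_dil; case: ifP => // _.
by rewrite coef_trunc // ltnS leq_div.
Qed.

(** An 11-th power is a series in q^11, so it leaves the extraction as a factor, with q^11 replaced
    by q. *)
Lemma coef11_frobeniusM (g f : fps F) n :
  (g ^+ 11 * f) (11 * n)%N = (g * Fps (fun m => f (11 * m)%N)) n.
Proof.
rewrite frobenius_fps; set h := Fps _.
have <- : dil 11 (g * h) (11 * n)%N = (g * h) n by rewrite coef_dil dvdn_mulr //
  mulKn.
rewrite dilM !coefMf; apply: eq_bigr => i _; rewrite !coef_dil.
case: ifP => dv; last by rewrite !mul0r.
rewrite dvdn_sub ?dvdn_mulr //=; congr (_ * f _).
by rewrite muln_divA ?mulKn // dvdn_sub // dvdn_mulr.
Qed.

(** The series 1/z and the modular lambda function l = y/z. *)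
Local Notation zi := (neg pb ^+ 4).
Local Notation l := (ys * zi).

Lemma t_inv : neg pb * t = 1.
Proof. by rewrite -negM pbar_theta4 neg1. Qed.

Lemma zi_zs : zi * zs = 1.
Proof. by rewrite -exprMn t_inv expr1n. Qed.

Lemma derf_l : derf l = l * xs.
Proof.
have h := theta_ode; have hi := zi_zs; have := congr1 (@derf F) hi.
move: h hi; move: (ys) => y; move: (xs) (zs) => x z; move: (zi) => u h hi.
rewrite derfM derf1 => hu.
have {}hu : derf u = - (u ^+ 2 * derf z).
  have -> : derf u = u * (derf u * z + u * derf z) - u * u * derf z +
    (1 - u * z) * derf u by ring.
  by rewrite hu hi; ring.
rewrite derfM hu.
have -> : derf y * u + y * - (u ^+ 2 * derf z) =
  u ^+ 2 * (z * derf y - y * derf z) + (1 - u * z) * u * derf y by ring.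
rewrite h hi subrr.
have -> : u ^+ 2 * (x * y * z) = (u * z) * u * x * y by ring.
by rewrite hi; ring.
Qed.

Lemma derf_exp11 (g : fps F) : derf (g ^+ 11) = 0.
Proof. by rewrite derfX nat11_fps !mul0r. Qed.

(** Multiplied by the unit k, the series is the derivative of g^11 l^k, and [derf] annihilates the
    exponents divisible by 11. *)
Lemma coef11_exact (g : fps F) k n : ~~ (11 %| k)%N ->
  (g ^+ 11 * xs * l ^+ k) (11 * n)%N = 0.
Proof.
case: k => // k ndv.
have : derf (g ^+ 11 * l ^+ k.+1) (11 * n)%N = 0.
  by rewrite coef_derf natrM; apply/eqP; rewrite !mulf_eq0.
rewrite derfM derf_exp11 mul0r add0r derfX derf_l [k.+1.-1]/=.
have -> : g ^+ 11 * (k.+1%:R * l ^+ k * (l * xs)) =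
  k.+1%:R * (g ^+ 11 * xs * l ^+ k.+1).
  by rewrite [l ^+ k.+1]exprS; move: (l) (k.+1%:R : fps F) (g ^+ 11) => *; ring.
rewrite coef_natM => /eqP; rewrite mulf_eq0 => /orP[|/eqP//].
rewrite -(dvdn_pcharf (pchar_Fp (isT : prime 11))) => dv.
by rewrite dv in ndv.
Qed.

(** With h(l) = z^(-5) and 1 - l = x/z, the factors after g^11 multiply to x^8 z^(-22) = w^32
    phi(q)^(-88). The powers chosen make 1/w differ from this by w^(-33) phi(q)^88, an 11-th
    power. *)
Lemma pbar_expand : let g := pb ^+ 3 * t ^+ 8 in
  pb = g ^+ 11 * xs * ((1 + 3%:R * l + l ^+ 2 + l ^+ 3 + 3%:R * l ^+ 4 +
    l ^+ 5) ^+ 3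
                      * (1 - l) ^+ 7).
Proof.
move=> g.
have hl : 1 + 3%:R * l + l ^+ 2 + l ^+ 3 + 3%:R * l ^+ 4 + l ^+ 5 = zi ^+ 5.
  rewrite -[RHS]mulr1 -[X in _ = _ * X]hasse_inv; have := zi_zs.
  move: (zs) (ys) => z y; move: (zi) => u hi.
  have -> : u ^+ 5 * (z ^+ 5 + 3%:R * z ^+ 4 * y + z ^+ 3 * y ^+ 2 +
    z ^+ 2 * y ^+ 3
      + 3%:R * z * y ^+ 4 + y ^+ 5) = (u * z) ^+ 5 +
        3%:R * (u * z) ^+ 4 * (y * u)
      + (u * z) ^+ 3 * (y * u) ^+ 2 + (u * z) ^+ 2 * (y * u) ^+ 3
      + 3%:R * (u * z) * (y * u) ^+ 4 + (y * u) ^+ 5 by ring.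
  by rewrite hi; ring.
have h1 : 1 - l = xs * zi by rewrite -{1}zi_zs; ring.
rewrite hl h1 /g; move: t_inv (pbar_theta4 F).
move: (t) (w) (neg pb) => T W V; move: (pb) => U hV hU.
have -> : (U ^+ 3 * T ^+ 8) ^+ 11 * W ^+ 4 *
  ((V ^+ 4) ^+ 5 ^+ 3 * (W ^+ 4 * V ^+ 4) ^+ 7) =
  U * (U * W) ^+ 32 * (V * T) ^+ 88.
  by ring.
by rewrite hV hU !expr1n !mulr1.
Qed.

(* The point is that the coefficient of l^11 is 0. *)
Lemma expand_l (l : fps F) :
  (1 + 3%:R * l + l ^+ 2 + l ^+ 3 + 3%:R * l ^+ 4 +
    l ^+ 5) ^+ 3 * (1 - l) ^+ 7 =
  1 - l ^+ 22 + (2%:R * l ^+ 1 + (- 12%:R) * l ^+ 2 + (- 8%:R) * l ^+ 3 +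
    71%:R * l ^+ 4 + (- 48%:R) * l ^+ 5 + (- 169%:R) * l ^+ 6 +
    340%:R * l ^+ 7 + (- 60%:R) * l ^+ 8 + (- 514%:R) * l ^+ 9 +
    625%:R * l ^+ 10 + (- 625%:R) * l ^+ 12 + 514%:R * l ^+ 13 +
    60%:R * l ^+ 14 + (- 340%:R) * l ^+ 15 + 169%:R * l ^+ 16 +
    48%:R * l ^+ 17 + (- 71%:R) * l ^+ 18 + 8%:R * l ^+ 19 + 12%:R * l ^+ 20 +
    (- 2%:R) * l ^+ 21).
Proof. by ring. Qed.

Lemma pbar11 n : pb (11 * n)%N = (w * (zs ^+ 2 - ys ^+ 2)) n.
Proof.
rewrite [LHS](congr1 (fun f : fps F => f _) pbar_expand) /=.
set g := pb ^+ 3 * t ^+ 8.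
rewrite expand_l mulrDr coefDf; set r := (X in _ + X = _).
(* The remainder r collects the l^k with k not divisible by 11, all killed by [coef11_exact]. *)
have -> : r = 0.
  have nulD u v : (g ^+ 11 * xs * u) (11 * n)%N = 0 ->
      (g ^+ 11 * xs * v) (11 * n)%N = 0 -> (g ^+ 11 * xs * (u +
        v)) (11 * n)%N = 0.
    by move=> hu hv; rewrite mulrDr coefDf hu hv addr0.
  have nul c k : ~~ (11 %| k)%N -> (g ^+ 11 * xs * (c%:R * l ^+ k)) (11 * n)%N =
    0.
    by move=> hk; rewrite mulrCA coef_natM coef11_exact // mulr0.
  have nulN c k : ~~ (11 %| k)%N -> (g ^+ 11 * xs * (- c%:R * l ^+ k)) (11 *
    n)%N = 0.
    by move=> hk; rewrite mulNr mulrN coefNf nul // oppr0.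
  by rewrite /r; repeat (apply: (nulD _ _);
    last by (apply: (nul) || apply: (nulN))); apply: (nul).
rewrite addr0 mulrBr mulr1 coefBf coef11_frobeniusM.
(* The power l^22 joins the 11-th power. As x is fixed by the extraction and g = z^2/w^3, what
   remains is g (1 - l^2) x = w (z^2 - y^2). *)
have -> : g ^+ 11 * xs * l ^+ 22 = (g * l ^+ 2) ^+ 11 * xs by move: (xs) (l) (g)
  => *; ring.
rewrite coef11_frobeniusM.
have -> : Fps (fun m => xs (11 * m)%N) = xs by apply: fpsP => m;
  apply: coef_xs11.
rewrite -coefBf; congr (coef _ n); rewrite /g.
have := zi_zs; have -> : t ^+ 8 = zs ^+ 2 by rewrite -exprM.
move: (zi) (zs) (ys) => u z y h.
have -> : pb ^+ 3 * z ^+ 2 * w ^+ 4 - pb ^+ 3 * z ^+ 2 * (y * u) ^+ 2 * w ^+ 4 =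
  (pb * w) ^+ 3 * w * (z ^+ 2 - y ^+ 2 * (u * z) ^+ 2) by ring.
by rewrite pbar_theta4 h !expr1n mul1r mulr1.
Qed.
End Atkin.

(** * Reindexing and splitting of sums over finite sets *)

Lemma reindex_fsbig_can (R : Type) (idx : R) (op : Monoid.com_law idx)
    (I J : choiceType) (h : I -> J) (g : J -> I) (P : set I) (Q : set J) (F : J
      -> R) :
  (forall i, P i -> Q (h i) /\ g (h i) = i) ->
  (forall j, Q j -> P (g j) /\ h (g j) = j) ->
  \big[op/idx]_(j \in Q) F j = \big[op/idx]_(i \in P) F (h i).
Proof.
move=> hP gQ; apply: reindex_fsbig; split.
- by move=> i /hP[].
- move=> i j; rewrite !inE => Pi Pj hij.
  by have [_ <-] := hP _ Pi; have [_ <-] := hP _ Pj; rewrite hij.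
- by move=> j /gQ[Pg <-]; exists (g j).
Qed.

Arguments reindex_fsbig_can {R idx op I J h g P Q}.

Lemma fsumID (R : nmodType) (I : choiceType) (B A : set I) (F : I -> R) :
  finite_set A ->
  \sum_(i \in A) F i = \sum_(i \in (A `&` B)%classic) F i +
                       \sum_(i \in (A `&` ~` B)%classic) F i.
Proof. exact: fsbigID. Qed.

Lemma fsumD (R : nmodType) (I : choiceType) (A : set I) (F G : I -> R) :
  finite_set A ->
  \sum_(i \in A) (F i + G i) = \sum_(i \in A) F i + \sum_(i \in A) G i.
Proof. exact: fsbig_split. Qed.

(** * Liouville's convolution and weight 4 *)

Section Liouville.
Local Open Scope classical_set_scope.

(** This indexes the convolution square of sigma over odd integers: a and b are divisors of the two
    summands, x and y their cofactors. *)
Definition oddrep (m : nat) : set (nat * nat * nat * nat) :=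
  [set p | let: (a, x, b, y) := p in
     [/\ odd a, odd x, odd b, odd y & (a * x + b * y = m)%N] ].

Lemma finite_oddrep m : finite_set (oddrep m).
Proof.
have fI : finite_set (`I_m.+1 `*` `I_m.+1 `*` `I_m.+1 `*` `I_m.+1) by
  do 3![apply: finite_setX; last exact: finite_II]; exact: finite_II.
apply: sub_finite_set fI => -[[[a x] b] y] /= [oa ox ob oy e].
have := odd_gt0 oa; have := odd_gt0 ox; have := odd_gt0 ob; have := odd_gt0 oy.
by move=> *; split; [split; [split|]|]; rewrite /= ltnS; nia.
Qed.

Lemma finite_oddrepI m A : finite_set (oddrep m `&` A).
Proof. exact/finite_setIl/finite_oddrep. Qed.

Definition swap_rep (p : nat * nat * nat * nat) :=
  (p.1.2, p.2, p.1.1.1, p.1.1.2).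

(* For a > b and c = a - b, the equation reads c x + b (x + y) = m; Dirichlet's
   bijection moves the multiple of c in b over to x. It turns a - b into a +
     b. *)
Definition dirichlet (p : nat * nat * nat * nat) : nat * nat * nat * nat :=
  let: (a, x, b, y) := p in
  let x' := (x + b %/ (a - b) * (x + y))%N in
  (a - b - b %% (a - b), x', b %% (a - b), x' + (x + y))%N.

Definition dirichlet_inv (p : nat * nat * nat * nat) : nat * nat * nat * nat :=
  let: (a, x, b, y) := p in
  let b' := (b + x %/ (y - x) * (a + b))%N in
  (b' + (a + b), x %% (y - x), b', y - x - x %% (y - x))%N.

Lemma dirichletP m p : (oddrep m `&` [set p | (p.1.2 < p.1.1.1)%N]) p ->
  (oddrep m `&` [set p | (p.1.1.2 < p.2)%N]) (dirichlet p) /\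
  dirichlet_inv (dirichlet p) = p.
Proof.
case: p => -[[a x] b] y [/= [oa ox ob oy e] /= lt_ba].
have [c ac] : exists c, a = (c + b)%N by exists (a - b)%N; lia.
have c0 : (0 < c)%N by lia.
(* As c is even, the remainder r is odd like b; in particular r > 0, and the new coordinates are odd
   and positive. *)
have ec : ~~ odd c by move: oa; rewrite ac oddD ob; case: (odd c).
subst a; rewrite !addnK; set k := (b %/ c)%N; set r := (b %% c)%N.
have bE : b = (k * c + r)%N by rewrite /k /r -divn_eq.
have rc : (r < c)%N by rewrite ltn_mod.
have or : odd r by move: ob; rewrite bE oddD oddM (negPf ec) andbF.
have x0 := odd_gt0 ox; have y0 := odd_gt0 oy; have r0 := odd_gt0 or.
split; first split=> /=.
- split=> //.
  + by rewrite oddB 1?ltnW // or (negPf ec).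
  + by rewrite oddD oddM oddD ox oy andbF.
  + by rewrite !oddD oddM oddD ox oy andbF.
  + have [d cd] : exists d, c = (d + r)%N by exists (c - r)%N; lia.
    rewrite {1}cd addnK -e bE cd; ring.
- lia.
rewrite addKn subnK 1?ltnW //.
have -> : ((x + k * (x + y)) %/ (x + y) = k)%N.
  by rewrite divnDMl ?divn_small //; lia.
have -> : ((x + k * (x + y)) %% (x + y) = x)%N.
  by rewrite addnC modnMDl modn_small //; lia.
by rewrite (addnC r) -bE addKn (addnC b).
Qed.

Lemma dirichlet_invP m p : (oddrep m `&` [set p | (p.1.1.2 < p.2)%N]) p ->
  (oddrep m `&` [set p | (p.1.2 < p.1.1.1)%N]) (dirichlet_inv p) /\
  dirichlet (dirichlet_inv p) = p.
Proof.
case: p => -[[a x] b] y [/= [oa ox ob oy e] /= lt_xy].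
have [z yz] : exists z, y = (z + x)%N by exists (y - x)%N; lia.
have z0 : (0 < z)%N by lia.
have ez : ~~ odd z by move: oy; rewrite yz oddD ox; case: (odd z).
subst y; rewrite !addnK; set k := (x %/ z)%N; set r := (x %% z)%N.
have xE : x = (k * z + r)%N by rewrite /k /r -divn_eq.
have rz : (r < z)%N by rewrite ltn_mod.
have or : odd r by move: ox; rewrite xE oddD oddM (negPf ez) andbF.
have a0 := odd_gt0 oa; have b0 := odd_gt0 ob; have r0 := odd_gt0 or.
split; first split=> /=.
- split=> //.
  + by rewrite !oddD oddM oddD oa ob andbF.
  + by rewrite oddD oddM oddD oa ob andbF.
  + by rewrite oddB 1?ltnW // or (negPf ez).
  + have [d zd] : exists d, z = (d + r)%N by exists (z - r)%N; lia.
    rewrite {1}zd addnK -e xE zd; ring.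
- lia.
rewrite addKn subnKC 1?ltnW //.
have -> : ((b + k * (a + b)) %/ (a + b) = k)%N.
  by rewrite divnDMl ?divn_small //; lia.
have -> : ((b + k * (a + b)) %% (a + b) = b)%N.
  by rewrite addnC modnMDl modn_small //; lia.
by rewrite addnK (addnC r) -xE (addnC x).
Qed.

Local Notation T := (nat * nat * nat * nat)%type.

Lemma oddrep_swap m (A B : set T) (F : T -> int) :
  (forall p, A p -> B (swap_rep p)) -> (forall p, B p -> A (swap_rep p)) ->
  (forall p, F (swap_rep p) = F p) ->
  \sum_(p \in oddrep m `&` B) F p = \sum_(p \in oddrep m `&` A) F p.
Proof.
move=> hA hB hF; rewrite (@reindex_fsbig_can _ _ _ _ _ swap_rep swap_rep
  (oddrep m `&` A)); first by apply: eq_fsbigr => p _.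
  by move=> [[[a x] b] y] [/= [oa ox ob oy <-] /hA hp]; do 2!split=> //;
    rewrite addnC.
by move=> [[[a x] b] y] [/= [oa ox ob oy <-] /hB hp]; do 2!split=> //;
  rewrite addnC.
Qed.

(** Write 4 a b = (a + b)^2 - (a - b)^2. Split the first square by the order of x and y, the second
    by the order of a and b. Dirichlet's bijection and the swap of (a, x) with (b, y) match the
    strict cases, and a = b gives 0, so only x = y survives. *)
Lemma liouville m : \sum_(p \in oddrep m) (p.1.1.1 * p.1.2)%:Z *+ 4 =
  \sum_(p \in oddrep m `&` [set p | p.1.1.2 = p.2]) ((p.1.1.1 + p.1.2) ^ 2)%:Z.
Proof.
pose Fp (p : T) : int := ((p.1.1.1 + p.1.2) ^ 2)%:Z.
pose Fm (p : T) : int := (p.1.1.1%:Z - p.1.2%:Z) ^+ 2.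
have three (f g : T -> nat) (F : T -> int) : 
    \sum_(p \in oddrep m) F p =
    \sum_(p \in oddrep m `&` [set p | (f p < g p)%N]) F p +
    \sum_(p \in oddrep m `&` [set p | (g p < f p)%N]) F p +
    \sum_(p \in oddrep m `&` [set p | f p = g p]) F p.
  rewrite (fsumID [set p | (f p < g p)%N] _ (finite_oddrep m)) -addrA;
    congr (_ + _).
  rewrite (fsumID [set p | (g p < f p)%N] _ (finite_oddrepI m _));
    congr (_ + _);
    by apply: eq_fsbigl; apply/seteqP; split=> p /= => [[[? ?] ?]|[? ?]];
      do ?split=> //; lia.
have sumE : \sum_(p \in oddrep m) Fp p = \sum_(p \in oddrep m) Fm p
   + \sum_(p \in oddrep m) (p.1.1.1 * p.1.2)%:Z *+ 4.
  rewrite -(fsumD _ _ (finite_oddrep m)); apply: eq_fsbigr => p _ /=.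
  by rewrite /Fp /Fm; lia.
apply: (addrI (\sum_(p \in oddrep m) Fm p)); rewrite -sumE -/Fp.
rewrite (three (fun p => p.1.1.2) (fun p => p.2)); congr (_ + _).
rewrite (three (fun p => p.1.2) (fun p => p.1.1.1)).
rewrite [X in _ = _ + X]fsbig1 ?addr0; last first.
  by move=> p [_ /= e]; rewrite /Fm e subrr.
have key : \sum_(p \in oddrep m `&` [set p | (p.1.1.2 < p.2)%N]) Fp p =
   \sum_(p \in oddrep m `&` [set p | (p.1.2 < p.1.1.1)%N]) Fm p.
  rewrite (reindex_fsbig_can _ (@dirichletP m) (@dirichlet_invP m)).
  apply: eq_fsbigr => -[[[a x] b] y]; rewrite inE /= => -[_ /= lt_ba].
  rewrite /Fp /Fm /= subnK; last by apply/ltnW; rewrite ltn_mod; lia.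
  by rewrite (subzn (ltnW lt_ba)) expr2 -PoszM mulnn.
rewrite key; congr (_ + _).
rewrite (@oddrep_swap m [set p | (p.1.1.2 < p.2)%N]) ?key //; last first.
  by move=> p; rewrite /Fp /= addnC.
by rewrite (@oddrep_swap m [set p | (p.1.2 < p.1.1.1)%N]) // => p;
  rewrite /Fm /=; lia.
Qed.

End Liouville.

(** * The convolution square of sigma over odd integers *)

Section OddSquares.
Local Open Scope classical_set_scope.

Lemma lambert_iota (R : comNzRingType) N n : (n <= N)%N ->
  lambert R n = \sum_(a <- iota 1 N | (a %| n)%N && odd (n %/ a)) a%:R.
Proof.
move=> le_nN; rewrite -(coef_lambert_part R le_nN) coef_sumf.
have -> : iota 1 N = index_iota 1 N.+1 by rewrite /index_iota subn1.
by rewrite big_add1 big_mkord [RHS]big_mkcond.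
Qed.

(** The sum of sigma(n) q^n over odd n; 16 times its reduction mod 11 is y. *)
Definition odd_lambert : fps int := Fps (fun n =>
  if odd n then lambert int n else 0).

Lemma odd_lambertE N n : (n <= N)%N -> odd_lambert n =
  \sum_(a <- iota 1 N) (if [&& odd a, (a %| n)%N &
    odd (n %/ a)] then a%:Z else 0).
Proof.
move=> le_nN.
have -> : odd_lambert n = if odd n then lambert int n else 0 by [].
rewrite (lambert_iota _ le_nN) big_mkcond.
case: ifP => on; last rewrite big1 //.
  apply: eq_bigr => a _; rewrite natz; case: (boolP (a %| n)%N) =>
    [/dvdnP[k nE]|]; last by rewrite andbF.
  by move: on; rewrite nE oddM => /andP[_ ->].
move=> a _; case: ifP => // /and3P[oa /dvdnP[k nE]].
move: on; rewrite nE oddM oa andbT => ok.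
by rewrite mulnK ?ok // odd_gt0.
Qed.

Lemma coef_odd_lambert_sqr n : (odd_lambert * odd_lambert) n =
  \sum_(p \in oddrep n) (p.1.1.1 * p.1.2)%:Z.
Proof.
pose P (p : nat * (nat * nat)) := [&& (p.1 <= n)%N,
   [&& odd p.2.1, p.2.1 %| p.1 & odd (p.1 %/ p.2.1)]%N &
   [&& odd p.2.2, p.2.2 %| (n - p.1) & odd ((n - p.1) %/ p.2.2)]%N].
pose r := allpairs pair (iota 0 n.+1) (allpairs pair (iota 1 n) (iota 1 n)).
have up : uniq (allpairs pair (iota 1 n) (iota 1 n)).
  by apply: allpairs_uniq; rewrite ?iota_uniq // => -[? ?] [? ?].
have ur : uniq r by apply: allpairs_uniq; rewrite ?iota_uniq // => -[? ?] [? ?].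
transitivity (\sum_(p <- r | P p) (p.2.1 * p.2.2)%:Z).
  rewrite coefMf -(big_mkord xpredT (fun i =>
    odd_lambert i * odd_lambert (n - i)%N)).
  rewrite [RHS]big_mkcond big_allpairs -[iota 0 n.+1]/(index_iota 0 n.+1).
  apply: eq_big_nat => i /andP[_]; rewrite ltnS => le_in.
  rewrite (odd_lambertE le_in) (odd_lambertE (leq_subr i n)).
  rewrite big_allpairs mulr_suml; apply: eq_bigr => a _.
  rewrite mulr_sumr; apply: eq_bigr => b _.
  rewrite /P /= le_in /=.
  by case: ifP => _; case: ifP => _; rewrite ?mul0r ?mulr0.
rewrite bigfs //; last first.
  move=> [i [a b]] /= /and3P[/= le_in /and3P[oa ai oi] /and3P[ob bi oj]] nr.
  have i0 : (0 < i)%N by case: (i) oi; rewrite ?div0n.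
  have j0 : (0 < n - i)%N by case: (n - i)%N oj; rewrite ?div0n.
  case/negP: nr; apply/allpairsP; exists (i, (a, b)); split=> //.
    by rewrite mem_iota.
  apply/allpairsP; exists (a, b); split=> //; rewrite mem_iota odd_gt0 //=.
    by rewrite add1n ltnS (leq_trans (dvdn_leq i0 ai)).
  by rewrite add1n ltnS (leq_trans (dvdn_leq j0 bi)) ?leq_subr.
pose h (p : nat * nat * nat * nat) := ((p.1.1.1 * p.1.1.2)%N, (p.1.1.1, p.1.2)).
pose g (p : nat * (nat * nat)) := (p.2.1, p.1 %/ p.2.1, p.2.2, (n - p.1) %/
  p.2.2)%N.
rewrite (@reindex_fsbig_can _ _ _ _ _ h g (oddrep n)) //.
  move=> [[[a x] b] y] /= [oa ox ob oy e].
  have a0 := odd_gt0 oa; have b0 := odd_gt0 ob.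
  split; last by rewrite /h /g /= -e addKn !mulKn.
  have hP : P (h (a, x, b, y)).
    by rewrite /P /h /= -e addKn !mulKn // !dvdn_mulr // oa ox ob oy leq_addr.
  exact: hP.
move=> [i [a b]] /and3P[/= le_in /and3P[oa ai oi] /and3P[ob bi oj]].
have e1 : (a * (i %/ a) = i)%N by rewrite mulnC divnK.
have e2 : (b * ((n - i) %/ b) = n - i)%N by rewrite mulnC divnK.
by rewrite /h /g /= e1; split=> //; split=> //; rewrite ?e1 e2 subnKC.
Qed.

Definition sigma3_odd (m : nat) : nat :=
  (\sum_(d <- iota 1 m | (d %| m) && odd (m %/ d)) d ^ 3)%N.

Lemma count_odd d m : (d <= m)%N ->
  (\sum_(a <- iota 0 m.*2) (if odd a && (a < d.*2) then 1 else 0) = d)%N.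
Proof.
move=> le_dm; rewrite -big_mkcond -(subnKC le_dm) doubleD iotaD big_cat /=.
rewrite [X in (_ + X)%N]big_seq_cond [X in (_ + X)%N]big1 ?addn0; last first.
  by move=> a /and3P[]; rewrite mem_iota add0n => /andP[le_da _] _;
    rewrite ltnNge le_da.
have -> : (\sum_(i <- iota 0 d.*2 | odd i && (i < d.*2)) 1 =
  \sum_(i <- iota 0 d.*2 | odd i) 1)%N.
  rewrite big_seq_cond [RHS]big_seq_cond; apply: eq_bigl => i.
  by rewrite mem_iota add0n; case: (i < d.*2)%N; rewrite ?andbT ?andbF.
elim: d {le_dm} => [|d IHd]; first by rewrite big_nil.
have -> : iota 0 d.+1.*2 = iota 0 d.*2 ++ [:: d.*2; d.*2.+1].
  by rewrite doubleS -addn2 iotaD.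
by rewrite big_cat IHd !big_cons big_nil /= odd_double /= addn1.
Qed.

(** When x = y the equation is x (a + b) = 2 m. With a + b = 2 d, the cofactor m/d = x is odd, and a
    runs over the d odd numbers below 2 d, each with weight 4 d^2. *)
Lemma diag_oddrep m : (0 < m)%N ->
  \sum_(p \in oddrep m.*2 `&` [set p | p.1.1.2 =
    p.2]) ((p.1.1.1 + p.1.2) ^ 2)%:Z
  = (4 * sigma3_odd m)%:Z.
Proof.
move=> m0.
pose P (p : nat * nat) := [&& (0 < p.1)%N, (p.1 %| m)%N, odd (m %/ p.1), odd p.2
  & (p.2 < p.1.*2)%N].
pose r := allpairs pair (iota 1 m) (iota 0 m.*2).
have ur : uniq r by apply: allpairs_uniq; rewrite ?iota_uniq // => -[? ?] [? ?].
transitivity (\sum_(p <- r | P p) (4 * p.1 ^ 2)%:Z); last first.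
  rewrite big_mkcond big_allpairs /sigma3_odd big_distrr /= raddf_sum /=
    [RHS]big_mkcond.
  rewrite !big_seq; apply: eq_bigr => d; rewrite mem_iota => /andP[d0].
  rewrite add1n ltnS => le_dm; rewrite /P /= d0 /=.
  case: (boolP (d %| m)%N) => //= _; last by rewrite big1.
  case: (boolP (odd (m %/ d))) => //= _; last by rewrite big1.
  have -> : (4 * d ^ 3 = 4 * d ^ 2 *
      \sum_(a <- iota 0 m.*2) (if odd a && (a < d.*2) then 1 else 0))%N.
    by rewrite count_odd // -mulnA -expnSr.
  rewrite big_distrr raddf_sum /=.
  by apply: eq_bigr => a _; case: ifP; rewrite ?muln1 ?muln0.
rewrite [RHS]bigfs //; last first.
  move=> [d a]; rewrite /P /= => /and5P[d0 dm _ _ lt_a] nr.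
  have le_dm := dvdn_leq m0 dm.
  case/negP: nr; apply/allpairsP; exists (d, a); split=> //;
    rewrite mem_iota ?d0 //=; lia.
pose h (p : nat * nat * nat * nat) := ((p.1.1.1 + p.1.2)./2, p.1.1.1).
pose g (p : nat * nat) := (p.2, m %/ p.1, p.1.*2 - p.2, m %/ p.1)%N.
rewrite (@reindex_fsbig_can _ _ _ _ _ h g (oddrep m.*2 `&` [set p | p.1.1.2 =
  p.2])).
- apply: eq_fsbigr => -[[[a x] b] y]; rewrite inE /= => -[[oa _ ob _ _] _].
  have : ~~ odd (a + b) by rewrite oddD oa ob.
  by move/even_halfK; lia.
- move=> [[[a x] b] y] [/= [oa ox ob oy e] /= xy]; subst y.
  have hh : ((a + b)./2.*2 = a + b)%N by rewrite even_halfK // oddD oa ob.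
  have d0 : (0 < (a + b)./2)%N by have := odd_gt0 oa; lia.
  have mE : (m = x * (a + b)./2)%N by nia.
  split; last by rewrite /h /g /= hh mE mulnK // addKn.
  have hP : P (h (a, x, b, x)).
    rewrite /P /h /= d0 oa hh mE dvdn_mull // mulnK // ox /=.
    by have := odd_gt0 ob; lia.
  exact: hP.
move=> [d a]; rewrite /P /= => /and5P[d0 /dvdnP[k mE] ok oa lt_a].
subst m; rewrite mulnK // in ok.
rewrite /h /g /= mulnK // subnKC ?doubleK 1?ltnW //.
split=> //; split=> //; split=> //; last by rewrite -mulnDl subnKC 1?ltnW //;
  lia.
by rewrite oddB 1?ltnW // odd_double oa.
Qed.

Lemma coef_odd_lambert_sqr_even m : (0 < m)%N ->
  (odd_lambert * odd_lambert) m.*2 = (sigma3_odd m)%:Z.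
Proof.
move=> m0; rewrite coef_odd_lambert_sqr.
have := liouville m.*2; rewrite diag_oddrep // => h.
apply: (@mulfI _ 4%:R) => //; rewrite mulr_fsumr.
transitivity ((4 * sigma3_odd m)%N%:Z); last by rewrite PoszM.
by rewrite -h; apply: eq_fsbigr => p _; rewrite mulr_natl.
Qed.

Lemma coef_odd_lambert_sqr_odd n : odd n -> (odd_lambert * odd_lambert) n = 0.
Proof.
move=> on; rewrite coef_odd_lambert_sqr fsbig1 // =>
  -[[[a x] b] y] [oa ox ob oy e].
by move: on; rewrite -e oddD !oddM oa ox ob oy.
Qed.
End OddSquares.

(** * The series x (y + z) as an Eisenstein series of weight 4 *)

Section WeightFour.
Local Notation F := 'F_11.
Local Notation w := (theta4 F).
Local Notation t := (theta3 F).
Local Notation xs := (w ^+ 4).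
Local Notation zs := (t ^+ 4).
Local Notation ys := (t ^+ 4 - w ^+ 4).

Definition sigma3 (m : nat) : nat := (\sum_(d <- iota 1 m | d %| m) d ^ 3)%N.

Definition sigma3_ser : fps F := Fps (fun n => (sigma3 n)%:R).
Definition sigma3_odd_ser : fps F := Fps (fun n => (sigma3_odd n)%:R).

Local Notation s := sigma3_ser.
Local Notation K := sigma3_odd_ser.

Lemma coef_ys_odd_lambert n : ys n = 16%:R * (odd_lambert n)%:~R.
Proof.
rewrite coef_ys; have -> : odd_lambert n = if odd n then lambert int n else 0 by
  [].
case: ifP => _; last by rewrite mulr0.
congr (_ * _); rewrite !coef_lambert rmorph_sum /=.
by apply: eq_bigr => k _; rewrite rmorph_nat.
Qed.

Lemma ys_sqr : ys ^+ 2 = 256%:R * dil 2 K.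
Proof.
apply: fpsP => n; rewrite expr2 coefMf coef_natM coef_dil.
under eq_bigr do rewrite !coef_ys_odd_lambert mulrACA -intrM.
rewrite -mulr_sumr -natrM; congr (_ * _).
transitivity (((odd_lambert * odd_lambert) n)%:~R : F).
  by rewrite coefMf rmorph_sum.
have [->|n0] := posnP n.
  rewrite dvdn0 div0n /= /sigma3_odd big_nil coef_mul0.
  by rewrite [odd_lambert 0%N]/= mul0r.
rewrite dvdn2; case: (boolP (odd n)) => on /=;
  first by rewrite coef_odd_lambert_sqr_odd.
have nE : n = (n./2).*2 by rewrite even_halfK.
rewrite {1}nE coef_odd_lambert_sqr_even; last by case: (n) n0 on => [|[]].
by rewrite divn2.
Qed.

Lemma dil_inj k (f g : fps F) : (0 < k)%N -> dil k f = dil k g -> f = g.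
Proof.
move=> k0 h; apply: fpsP => n.
have := congr1 (fun u : fps F => u (k * n)%N) h.
by rewrite !coef_dil dvdn_mulr // mulKn.
Qed.

(** By Landen, y^2 = 16 a^2 b^2 is 16 times z y taken at q^2, so [ys_sqr] determines z y. The factor
    16 has inverse 9, as 9 * 16 = 1 + 11 * 13. *)
Lemma zs_ys : zs * ys = 16%:R * K.
Proof.
apply: (@dil_inj 2) => //.
have h := ys_sqr; rewrite [ys]ysE in h.
have half (f g : fps F) : 16%:R * f = 16%:R * g -> f = g.
  move=> e; have -> : f = 9%:R * (16%:R * f) - 11%:R * (13%:R * f) by ring.
  have -> : g = 9%:R * (16%:R * g) - 11%:R * (13%:R * g) by ring.
  by rewrite e nat11_fps !mul0r.
apply: half; rewrite [dil 2 (_ * K)]dilM dil_nat mulrA -natrM -h.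
by rewrite dilM dil_zs dil_ys; ring.
Qed.

(** The divisors d of n with n/d even are the divisors of n/2. *)
Lemma sigma3_oddE n : (0 < n)%N ->
  (sigma3_odd n + (if (2 %| n)%N then sigma3 (n %/ 2) else 0) = sigma3 n)%N.
Proof.
move=> n0; rewrite /sigma3 [RHS](bigID (fun d => odd (n %/ d))) /=; congr addn.
case: ifP => [/dvdnP[k nE]|n2].
  rewrite nE mulnK //; have k0 : (0 < k)%N by case: (k) nE n0 => // ->.
  have -> : iota 1 (k * 2) = iota 1 k ++ iota k.+1 k.
    by rewrite muln2 -addnn iotaD add1n.
  rewrite big_cat /= [X in (_ + X)%N]big_seq_cond [X in (_ + X)%N]big1 ?addn0.
    rewrite big_seq_cond [RHS]big_seq_cond; apply: eq_bigl => d.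
    rewrite mem_iota; case: (boolP (_ <= _ < _)%N) => //= /andP[d0 _].
    apply/idP/idP => [/dvdnP[j ->]|/andP[/dvdnP[j e]]].
      by rewrite -mulnA (mulnC d) mulnA mulnK // oddM andbF dvdn_mull.
    rewrite e mulnK // => /even_halfK jE.
    by apply/dvdnP; exists j./2; move: jE e; rewrite -muln2; nia.
  move=> d /andP[]; rewrite mem_iota => /andP[lt_kd _] /andP[/dvdnP[[|[|j]]]].
  - by rewrite mul0n; nia.
  - by rewrite mul1n => ->; rewrite divnn; case: d lt_kd.
  by nia.
rewrite big1 // => d /andP[/dvdnP[j e]].
have d0 : (0 < d)%N by case: (d) e n0 => // ->; rewrite muln0.
by rewrite e mulnK // => ej; move: n2; rewrite e dvdn2 oddM negb_and ej.
Qed.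

(** A divisor d of 2 n with odd cofactor is even; halving it keeps the cofactor and divides the cube
    by 8. *)
Lemma sigma3_odd2 n : (sigma3_odd n.*2 = 8 * sigma3_odd n)%N.
Proof.
have [->|n0] := posnP n; first by rewrite /sigma3_odd !big_nil.
have evens m (f : nat -> nat) : (forall d, odd d -> f d = 0%N) ->
    (\sum_(d <- iota 1 m.*2) f d = \sum_(d <- iota 1 m) f d.*2)%N.
  move=> f0; elim: m => [|m IHm]; first by rewrite !big_nil.
  have -> : iota 1 m.+1 = iota 1 m ++ [:: m.+1] by have := iotaD 1 m 1;
    rewrite addn1.
  have -> : iota 1 m.+1.*2 = iota 1 m.*2 ++ [:: m.*2.+1; m.*2.+2].
    by have := iotaD 1 m.*2 2; rewrite addn2 add1n doubleS.
  by rewrite !big_cat IHm !big_cons !big_nil /= f0 ?addn0 ?add0n //= odd_double.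
rewrite /sigma3_odd big_mkcond evens => [|d od]; last first.
  case: ifP => // /andP[/dvdnP[j e]].
  by rewrite e mulnK ?odd_gt0 // => oj; have := odd_double n;
    rewrite e oddM oj od.
rewrite big_distrr [RHS]big_mkcond /=; apply: eq_bigr => d _.
by rewrite -!muln2 dvdn_pmul2r // divnMr // expnMn mulnC.
Qed.

Lemma coef_sigma3_rec n : (0 < n)%N ->
  (s n.*2 + 8%:R * (dil 2 s) n = 9%:R * s n).
Proof.
move=> n0; rewrite coef_dil /=.
have h := sigma3_oddE n0.
have := sigma3_oddE (n := n.*2); rewrite sigma3_odd2 -muln2 dvdn_mull // mulnK
  // muln2.
rewrite double_gt0 => /(_ n0) h2.
have -> : (if (2 %| n)%N then (sigma3 (n %/ 2))%:R else 0) =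
   (if (2 %| n)%N then sigma3 (n %/ 2) else 0%N)%:R :> F by case: ifP.
by rewrite -!natrM -natrD; congr _%:R; lia.
Qed.

(** The Hecke relation at 2 for sigma_3: s + [neg s] is twice the even part of s. *)
Lemma sigma3_ser_rec : s + neg s + 16%:R * dil 4 s = 18%:R * dil 2 s.
Proof.
apply: fpsP => n; rewrite !coefDf !coef_natM coef_neg -(@dil_comp _ 2 2) //
  (coef_dil 2 _ n).
rewrite (coef_dil 2 s n) -signr_odd; case: (boolP (odd n)) => on.
  by rewrite !ifF ?dvdn2 ?on // expr1; ring.
have nE : n = (n./2).*2 by rewrite even_halfK.
rewrite !ifT ?dvdn2 // expr0 mul1r divn2 [in LHS]nE doubleK.
have [->|n0] := posnP n./2.
  by rewrite ?coef_dil /= /sigma3 big_nil; ring.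
transitivity (2%:R * (s n./2.*2 + 8%:R * (dil 2 s) n./2)); first by ring.
by rewrite coef_sigma3_rec //; ring.
Qed.

Lemma K_sigma3 : K = s - dil 2 s.
Proof.
apply: fpsP => n; rewrite coefBf coef_dil /=; have [->|n0] := posnP n.
  by rewrite /sigma3_odd /sigma3 !big_nil subr0.
rewrite -(sigma3_oddE n0) natrD.
by case: ifP => _; rewrite ?addrK ?addr0 ?subr0.
Qed.

(** This is x (y + z), since x = z - y. *)
Definition weight4 : fps F := zs ^+ 2 - ys ^+ 2.

(** The substitution q -> -q exchanges x and z, so it sends z y to -x y. *)
Lemma xs_ys : xs * ys = - (16%:R * neg K).
Proof.
have h := congr1 (@neg F) zs_ys; move: h; rewrite !negM neg_nat negB !negX.
rewrite /theta3 negK => <-; ring.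
Qed.

(** Both [weight4] and the Eisenstein series c below satisfy f + 16 K(-q) = g(q^2) with g = f + 32
    K(-q); for [weight4], g = x^2 and x z = x(q^2)^2. So their difference is invariant under q ->
    q^2. *)
Lemma weight4_sigma3 n : (0 < n)%N ->
  weight4 n = 16%:R * (16%:R * (dil 4 s) n - (-1) ^+ n * s n).
Proof.
move=> n0.
have hx : xs ^+ 2 = weight4 + 32%:R * neg K.
  have -> : xs ^+ 2 = weight4 - 2%:R * (xs * ys) by rewrite /weight4; ring.
  by rewrite xs_ys; ring.
have hz : weight4 = dil 2 (xs ^+ 2) - 16%:R * neg K.
  have -> : weight4 = (w * t) ^+ 4 + xs * ys by rewrite /weight4; ring.
  by rewrite xs_ys theta34 !dilX -!exprM.
pose c : fps F := 16%:R * (16%:R * dil 4 s - neg s).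
have negdil (f : fps F) : neg (dil 2 f) = dil 2 f.
  apply: fpsP => m; rewrite coef_neg coef_dil; case: ifP; rewrite ?mulr0 //.
  by rewrite dvdn2 -signr_odd => /negPf->; rewrite mul1r.
have hc : c + 16%:R * neg K = dil 2 (c + 32%:R * neg K).
  rewrite K_sigma3 negB negdil /c.
  have -> : 16%:R * (16%:R * dil 4 s - neg s) + 32%:R * (neg s - dil 2 s) =
    256%:R * dil 2 s - 16%:R * s.
    transitivity (16%:R * (s + neg s + 16%:R * dil 4 s) - 16%:R * s - 32%:R *
      dil 2 s).
      by ring.
    by rewrite sigma3_ser_rec; ring.
  by rewrite dilB !dilM !dil_nat dil_comp //; ring.
have hz' : dil 2 (xs ^+ 2) = weight4 + 16%:R * neg K by rewrite [weight4]hz;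
  ring.
have fixed : dil 2 (weight4 - c) = weight4 - c.
  have -> : weight4 - c = (weight4 + 32%:R * neg K) - (c +
    32%:R * neg K) by ring.
  by rewrite dilB -hx -hc hz' hx; ring.
have := dil_fix (isT : (1 < 2)%N) fixed n0.
move/eqP; rewrite coefBf subr_eq0 => /eqP ->.
by rewrite /c coef_natM coefBf coef_natM coef_neg.
Qed.
End WeightFour.

(** * Zagier's sums over quadratic forms *)

Section Zagier.
Local Open Scope classical_set_scope.
Local Notation form := (int * int * int)%type.

Definition qf (f : form) (x y : int) : int :=
  f.1.1 * x ^+ 2 + f.1.2 * x * y + f.2 * y ^+ 2.

Definition disc (f : form) : int := f.1.2 ^+ 2 - 4%:Z * f.1.1 * f.2.

Definition zforms (D x y : int) : set form :=
  [set f | [/\ disc f = D, f.1.1 < 0 & 0 < qf f x y] ].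

(** For y nonzero this is y^6 times Zagier's sum of f(x/y)^3. *)
Definition zsum (D x y : int) : int := \sum_(f \in zforms D x y) qf f x y ^+ 3.

Lemma finite_box (N : int) :
  finite_set [set f : form | [/\ `|f.1.1| <= N, `|f.1.2| <= N & `|f.2| <= N] ].
Proof.
have f1 : finite_set [set z : int | `|z| <= N].
  have fi := finite_image (fun n : nat => n%:Z - N) (finite_II (absz N).*2.+1).
  apply: sub_finite_set fi => z /= hz; exists (absz (z + N)); rewrite /=; lia.
have fi := finite_setX (finite_setX f1 f1) f1.
by apply: sub_finite_set fi => -[[a b] c] /= [].
Qed.

Lemma normz_le_sqr (z : int) : `|z| <= z ^+ 2.
Proof.
have [->|z0] := eqVneq z 0; first by rewrite normr0.
by rewrite -(real_normK (num_real z)) expr2 ler_peMr //; lia.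
Qed.

(** With v = f(x, y) > 0 and u = 2 a x + b y one has u^2 = D y^2 + 4 a v, where a v <= a < 0. This
    bounds a and u, then b, and the discriminant bounds c. *)
Lemma finite_zforms D x y : y != 0 -> finite_set (zforms D x y).
Proof.
move=> y0; pose M := D * y ^+ 2; pose N := M + 2%:Z * M * `|x|.
have fi := finite_box (M + N + N ^+ 2 + `|D|).
apply: sub_finite_set fi => -[[a b] c] [/= dE a0 v0].
set v := qf _ _ _ in v0; pose u := 2%:Z * a * x + b * y.
have uE : u ^+ 2 = M + 4%:Z * a * v by rewrite /u /M -dE /disc /v /qf /=; ring.
have av : a * v <= a.
  have := mulr_le0_ge0 (ltW a0) (_ : 0 <= v - 1); rewrite mulrBr mulr1 subr_le0.
  by apply; rewrite subr_ge0; lia.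
have Ma : - a <= M.
  have := sqr_ge0 u; rewrite uE -mulrA; lia.
have M0 : 0 < M by lia.
have uM : `|u| <= M.
  apply: le_trans (normz_le_sqr u) _; rewrite uE -mulrA; lia.
have xM : - a * `|x| <= M * `|x| by apply: ler_wpM2r.
have bN : `|b| <= N.
  apply: (@le_trans _ _ `|b * y|); first by rewrite normrM ler_peMr //; lia.
  have -> : b * y = u - 2%:Z * a * x by rewrite /u; ring.
  apply: le_trans (ler_normB _ _) _; rewrite /N -(mulrA 2%:Z) -(mulrA 2%:Z M)
    lerD // !normrM.
  by rewrite (ltr0_norm a0) -[`|2%:Z|]/2%:Z ler_pM2l //.
have b2 : b ^+ 2 <= N ^+ 2.
  rewrite -subr_ge0; have -> : N ^+ 2 - b ^+ 2 = (N - b) * (N + b) by ring.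
  by apply: mulr_ge0; lia.
have N0 : 0 <= N by lia.
have b0 := sqr_ge0 b.
have cN : `|c| <= N ^+ 2 + `|D|.
  apply: (@le_trans _ _ `|4%:Z * a * c|).
    by rewrite normrM ler_peMl // normrM; lia.
  have -> : 4%:Z * a * c = b ^+ 2 - D by rewrite -dE /disc /=; ring.
  lia.
by split=> /=; lia.
Qed.

Definition zsum0 D := zsum D 0 1.

Lemma qf01 f : qf f 0 1 = f.2.
Proof. by rewrite /qf; ring. Qed.

Lemma zsum0E D : zsum0 D = \sum_(f \in zforms D 0 1) f.2 ^+ 3.
Proof. by apply: eq_fsbigr => f _; rewrite qf01. Qed.

Lemma zsum_shift D x y : zsum D (x + y) y = zsum D x y.
Proof.
pose h (f : form) : form := (f.1.1, f.1.2 + 2%:Z * f.1.1, f.1.1 + f.1.2 + f.2).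
pose g (f : form) : form := (f.1.1, f.1.2 - 2%:Z * f.1.1, f.1.1 - f.1.2 + f.2).
have hq f : qf (h f) x y = qf f (x + y) y by rewrite /qf /h /=; ring.
have gq f : qf (g f) (x + y) y = qf f x y by rewrite /qf /g /=; ring.
have hd f : disc (h f) = disc f by rewrite /disc /h /=; ring.
have gd f : disc (g f) = disc f by rewrite /disc /g /=; ring.
rewrite /zsum [RHS](@reindex_fsbig_can _ _ _ _ _ h g (zforms D (x + y) y)).
- by apply: eq_fsbigr => f _; rewrite hq.
- move=> [[a b] c] [fD a0 f0]; split; first by split; rewrite ?hd ?hq.
  by rewrite /h /g /=; congr (_, _, _); ring.
- move=> [[a b] c] [fD a0 f0]; split; first by split; rewrite ?gd ?gq.
  by rewrite /h /g /=; congr (_, _, _); ring.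
Qed.

Lemma zsum_oppx D x y : zsum D (- x) y = zsum D x y.
Proof.
pose h (f : form) : form := (f.1.1, - f.1.2, f.2).
have hq f z : qf (h f) z y = qf f (- z) y by rewrite /qf /h /=; ring.
have hd f : disc (h f) = disc f by rewrite /disc /h /=; ring.
have hK f : h (h f) = f by case: f => -[a b] c; rewrite /h /= opprK.
rewrite /zsum [RHS](@reindex_fsbig_can _ _ _ _ _ h h (zforms D (- x) y)).
- by apply: eq_fsbigr => f _; rewrite hq.
- by move=> f [fD a0 f0]; split=> //; split; rewrite ?hd ?hq.
- by move=> f [fD a0 f0]; split=> //; split; rewrite ?hd ?hq ?opprK.
Qed.

Lemma zsum_shiftn D x y k : zsum D (x + k%:Z * y) y = zsum D x y.
Proof.
elim: k => [|k IHk]; first by rewrite mul0r addr0.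
by rewrite -addn1 PoszD mulrDl mul1r addrA zsum_shift.
Qed.

Lemma zsum_0y D (y : int) : y != 0 -> zsum D 0 y = y ^+ 6 * zsum0 D.
Proof.
move=> y0; have q0 f : qf f 0 y = f.2 * y ^+ 2 by rewrite /qf; ring.
have y2 : 0 < y ^+ 2 by rewrite exprn_even_gt0.
rewrite zsum0E mulr_fsumr /zsum.
have -> : zforms D 0 y = zforms D 0 1.
  by apply/seteqP; split=> f; rewrite /zforms /= qf01 q0 pmulr_lgt0.
by apply: eq_fsbigr => f _; rewrite q0; ring.
Qed.

Definition nonsquare (D : int) := forall k : int, k ^+ 2 != D.

(** Exchanging a and c turns [zsum D y x] into a sum over c < 0 < f(x, y). The forms with a, c < 0
    cancel. There remain a < 0 < c with f > 0, and c < 0 < a with f > 0, which f -> -f turns into a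
    < 0 < c with f < 0. As D is not a square, a and c never vanish. *)
Lemma zsum_swap D x y : nonsquare D -> x != 0 -> y != 0 ->
  zsum D x y - zsum D y x = \sum_(f \in zforms D 0 1) qf f x y ^+ 3.
Proof.
move=> nsD x0 y0.
have c_neq0 f : disc f = D -> f.2 != 0.
  move=> fD; apply/eqP => c0; have /eqP[] := nsD f.1.2.
  by rewrite -fD /disc c0; ring.
have a_neq0 f : disc f = D -> f.1.1 != 0.
  move=> fD; apply/eqP => c0; have /eqP[] := nsD f.1.2.
  by rewrite -fD /disc c0; ring.
pose sw (f : form) : form := (f.2, f.1.2, f.1.1).
have swq f u v : qf (sw f) u v = qf f v u by rewrite /qf /sw /=; ring.
have swd f : disc (sw f) = disc f by rewrite /disc /sw /=; ring.
have swK f : sw (sw f) = f by case: f => -[a b] c.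
pose C := [set f : form | [/\ disc f = D, f.2 < 0 & 0 < qf f x y] ].
have Cfin : finite_set C.
  apply: sub_finite_set (finite_image sw (finite_zforms D y x0)) =>
    f [fD c0 f0].
  by exists (sw f); rewrite ?swK //; split; rewrite ?swd ?swq.
have zC : zsum D y x = \sum_(f \in C) qf f x y ^+ 3.
  rewrite /zsum [RHS](@reindex_fsbig_can _ _ _ _ _ sw sw (zforms D y x)).
  - by apply: eq_fsbigr => f _; rewrite swq.
  - by move=> f [fD a0 f0]; split=> //; split; rewrite ?swd ?swq.
  - by move=> f [fD a0 f0]; split=> //; split; rewrite ?swd ?swq.
pose op (f : form) : form := (- f.1.1, - f.1.2, - f.2).
have opq f u v : qf (op f) u v = - qf f u v by rewrite /qf /op /=; ring.
have opd f : disc (op f) = disc f by rewrite /disc /op /=; ring.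
have opK f : op (op f) = f by case: f => -[a b] c; rewrite /op /= !opprK.
have Zfin := finite_zforms D x y0.
have Pfin := finite_zforms D 0 (oner_neq0 int).
rewrite {}zC [zsum D x y](fsumID [set f : form | f.2 < 0] _ Zfin).
rewrite (fsumID [set f : form | f.1.1 < 0] _ Cfin).
have -> : C `&` [set f | f.1.1 < 0] = zforms D x y `&` [set f | f.2 < 0].
  by apply/seteqP; split=> f [[? ? ?] ?].
rewrite [RHS](fsumID [set f : form | 0 < qf f x y] _ Pfin).
have -> : zforms D x y `&` ~` [set f | f.2 < 0] =
  zforms D 0 1 `&` [set f | 0 < qf f x y].
  apply/seteqP; split=> f; rewrite /zforms /= qf01.
    by move=> [[fD a0 f0] c0]; split=> //; split=> //; have := c_neq0 f fD; lia.
  by move=> [[fD a0 f0] c0]; split=> //; lia.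
have Pfin' := finite_setIl (~` [set f : form | 0 < qf f x y]) Pfin.
rewrite (fsumID [set f : form | qf f x y < 0] _ Pfin').
rewrite [X in _ = _ + (_ + X)]fsbig1 ?addr0; last first.
  move=> f [[_ /= h1] h2]; have -> : qf f x y = 0 by lia.
  by rewrite expr0n.
rewrite [X in _ + X - _](_ : _ = \sum_(f \in zforms D 0 1 `&` [set f | 0 < qf f
  x y]) qf f x y ^+ 3) //.
set S1 := \sum_(f \in _ `&` [set f | f.2 < 0]) _.
set S2 := \sum_(f \in _ `&` [set f | 0 < qf f x y]) _.
suff -> : \sum_(f \in C `&` ~` [set f | f.1.1 < 0]) qf f x y ^+ 3 =
  - \sum_(f \in zforms D 0 1 `&` ~` [set f | 0 < qf f x y] `&` [set f | qf f x y
    < 0]) qf f x y ^+ 3.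
  by ring.
rewrite -mulN1r mulr_fsumr.
rewrite (@reindex_fsbig_can _ _ _ _ _ op op (zforms D 0 1 `&` ~` [set f | 0 < qf
  f x y] `&` [set f | qf f x y < 0])).
- by apply: eq_fsbigr => f _; rewrite opq; ring.
- move=> f [[[fD a0]]]; rewrite qf01 => c0 _ /= f0; rewrite opK; split=> //.
  by split; [split; rewrite ?opd ?opq // | ]; rewrite /op /=; lia.
- move=> f [[fD c0 f0] /= a0]; rewrite opK; split=> //.
  have := a_neq0 _ fD => a1.
  by split; [split; [split; rewrite ?opd ?qf01 // | ] | ];
    rewrite /= ?opq /op /=; lia.
Qed.

(** * The period polynomial and the independence of x/y *)

Section Constant.
Variables (D : int) (nsD : nonsquare D).

Local Notation S F := (\sum_(f \in zforms D 0 1) (F f : int)).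
Let Pfin : finite_set (zforms D 0 1) := finite_zforms D 0 (oner_neq0 int).

Lemma moment_opp (F : form -> int) :
  S (fun f => F (f.1.1, - f.1.2, f.2)) = S F.
Proof.
pose h (f : form) : form := (f.1.1, - f.1.2, f.2).
have hd f : disc (h f) = disc f by rewrite /disc /h /=; ring.
have hK f : h (h f) = f by case: f => -[a b] c; rewrite /h /= opprK.
rewrite [RHS](@reindex_fsbig_can _ _ _ _ _ h h (zforms D 0 1)) //.
  by move=> f [fD a0]; rewrite qf01 => f0; split=> //; split; rewrite ?hd ?qf01.
by move=> f [fD a0]; rewrite qf01 => f0; split=> //; split; rewrite ?hd ?qf01.
Qed.

Lemma moment_swap (F : form -> int) :
  S (fun f => F (- f.2, f.1.2, - f.1.1)) = S F.
Proof.
pose h (f : form) : form := (- f.2, f.1.2, - f.1.1).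
have hd f : disc (h f) = disc f by rewrite /disc /h /=; ring.
have hK f : h (h f) = f by case: f => -[a b] c; rewrite /h /= !opprK.
rewrite [RHS](@reindex_fsbig_can _ _ _ _ _ h h (zforms D 0 1)) //;
  by move=> f [fD a0]; rewrite qf01 => f0; split=> //; split;
    rewrite ?hd ?qf01 /h //=; lia.
Qed.

Lemma moment_odd (F : form -> int) :
  (forall f, F (f.1.1, - f.1.2, f.2) = - F f) -> S F = 0.
Proof.
move=> Fodd; have := moment_opp F.
have -> : S (fun f => F (f.1.1, - f.1.2, f.2)) = - S F.
  by rewrite -mulN1r mulr_fsumr; apply: eq_fsbigr => f _; rewrite Fodd mulN1r.
by move=> h; lia.
Qed.

Lemma moment_anti (F G : form -> int) :
  (forall f, F (- f.2, f.1.2, - f.1.1) = - G f) -> S F = - S G.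
Proof.
move=> FG; rewrite -moment_swap -[RHS]mulN1r mulr_fsumr.
by apply: eq_fsbigr => f _; rewrite FG mulN1r.
Qed.

(** The coefficient of x^4 y^2 in the sum of the f(x, y)^3 with a < 0 < c. *)
Definition zmu := S (fun f => 3%:Z * f.1.1 ^+ 2 * f.2 +
  3%:Z * f.1.1 * f.1.2 ^+ 2).

(** The symmetry b -> -b kills the odd moments, and (a, b, c) -> (-c, b, -a) makes the polynomial
    antisymmetric in x and y. *)
Lemma zsum_period x y : S (fun f => qf f x y ^+ 3) =
  zsum0 D * (y ^+ 6 - x ^+ 6) + zmu * (x ^+ 4 * y ^+ 2 - x ^+ 2 * y ^+ 4).
Proof.
pose m1 (f : form) : int := f.1.1 ^+ 2 * f.1.2;
  pose m2 (f : form) : int := f.1.2 * f.2 ^+ 2.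
pose m3 (f : form) : int := 6%:Z * f.1.1 * f.1.2 * f.2 + f.1.2 ^+ 3.
pose a3 (f : form) : int := f.1.1 ^+ 3; pose c3 (f : form) : int := f.2 ^+ 3.
pose u (f : form) : int := 3%:Z * f.1.1 ^+ 2 * f.2 + 3%:Z * f.1.1 * f.1.2 ^+ 2.
pose v (f : form) : int := 3%:Z * f.1.1 * f.2 ^+ 2 + 3%:Z * f.1.2 ^+ 2 * f.2.
have -> : S (fun f => qf f x y ^+ 3) = x ^+ 6 * S a3 + 3%:Z * x ^+ 5 * y * S m1
   + x ^+ 4 * y ^+ 2 * S u + x ^+ 3 * y ^+ 3 * S m3 + x ^+ 2 * y ^+ 4 * S v
   + 3%:Z * x * y ^+ 5 * S m2 + y ^+ 6 * S c3.
  rewrite !mulr_fsumr -!(fsumD _ _ Pfin); apply: eq_fsbigr => f _.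
  by rewrite /qf /a3 /m1 /u /m3 /v /m2 /c3; ring.
have -> : S m1 = 0 by apply: moment_odd => f; rewrite /m1 /=; ring.
have -> : S m2 = 0 by apply: moment_odd => f; rewrite /m2 /=; ring.
have -> : S m3 = 0 by apply: moment_odd => f; rewrite /m3 /=; ring.
have -> : S a3 = - S c3 by apply: moment_anti => f; rewrite /a3 /c3 /=; ring.
have -> : S v = - S u by apply: moment_anti => f; rewrite /u /v /=; ring.
by rewrite /zmu zsum0E -/(S u) -/(S c3); ring.
Qed.

(* The period relations at 1/2, 1/3 and 2/3 kill the second even period
   polynomial. *)
Lemma zmu0 : zmu = 0.
Proof.
have sw x y := @zsum_swap D x y nsD.
have z11 k : zsum D k%:Z 1 = zsum0 D by have := zsum_shiftn D 0 1 k;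
  rewrite add0r mulr1.
have h2 := sw 2 1 isT isT; have h3 := sw 3 1 isT isT;
  have h23 := sw 2 3 isT isT.
rewrite zsum_period (z11 2%N) in h2; rewrite zsum_period (z11 3%N) in h3.
rewrite zsum_period in h23.
(* Use 2/3 = 1 - 1/3 here and 3/2 = 1 + 1/2 next; the three relations then give -60 [zmu] = -180
   [zmu]. *)
have e1 : zsum D 2 3 = zsum D 1 3 by rewrite -(zsum_oppx D 1) -(zsum_shift D
  (-1) 3).
have e2 : zsum D 3 2 = zsum D 1 2 by rewrite -(zsum_shift D 1 2).
rewrite e1 e2 in h23; lia.
Qed.

(** Euclid's algorithm: translations reduce x modulo y, and the swap exchanges the two at the cost
    of [zsum0 D] times y^6 - x^6, which the claimed value satisfies as well. *)
Lemma zsum_const (x y : nat) : (0 < y)%N -> zsum D x%:Z y%:Z =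
  y%:Z ^+ 6 * zsum0 D.
Proof.
elim/ltn_ind: y x => y IHy x y0.
have yN0 : y%:Z != 0 by lia.
rewrite (divn_eq x y) PoszD PoszM addrC zsum_shiftn.
have [->|r0] := posnP (x %% y); first exact: zsum_0y.
have lt_r : (x %% y < y)%N by rewrite ltn_mod.
have rN0 : (x %% y)%:Z != 0 by lia.
have := zsum_swap nsD rN0 yN0; rewrite zsum_period zmu0 (IHy _ lt_r y r0) => h.
have -> : zsum D (x %% y)%N y = (x %% y)%:Z ^+ 6 * zsum0 D +
  (zsum0 D * (y%:Z ^+ 6 - (x %% y)%:Z ^+ 6) +
    0 * ((x %% y)%:Z ^+ 4 * y%:Z ^+ 2 - (x %% y)%:Z ^+ 2 * y%:Z ^+ 4)).
  by rewrite -h; ring.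
by ring.
Qed.
End Constant.
End Zagier.

Lemma dvdz_addr (d m n : int) : (d %| m)%Z -> (d %| m + n)%Z = (d %| n)%Z.
Proof. exact: rpredDl. Qed.

Lemma dvdz_addl (d m n : int) : (d %| n)%Z -> (d %| m + n)%Z = (d %| m)%Z.
Proof. exact: rpredDr. Qed.

Lemma dvdz_subl (d m n : int) : (d %| n)%Z -> (d %| m - n)%Z = (d %| m)%Z.
Proof. exact: rpredBr. Qed.

Lemma fsum_exchange (R : nmodType) (I : choiceType) (A : set I) n (F : I -> 'I_n
  -> R) :
  finite_set A ->
  \sum_(i \in A) \sum_(j < n) F i j = \sum_(j < n) \sum_(i \in A) F i j.
Proof.
move=> Afin; rewrite fsbig_finite // exchange_big /=.
by apply: eq_bigr => j _; rewrite fsbig_finite.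
Qed.

Lemma fsum_cond (R : nmodType) (I : choiceType) (A : set I) (b : pred I) (F : I
  -> R) :
  \sum_(i \in A) (if b i then F i else 0) =
    \sum_(i \in (A `&` [set i | b i])%classic) F i.
Proof.
rewrite fsbig_mkcondr; apply: eq_fsbigr => i _.
case: ifP => bi; first by rewrite ifT // inE.
by rewrite ifF //; apply/negP; rewrite inE /= bi.
Qed.

(** * Hecke operators *)

Section Hecke.
Local Notation form := (int * int * int)%type.
Variables (p : nat) (p_prime : prime p) (p_odd : odd p).

Local Notation q := (p%:Z).

Lemma q_neq0 : q != 0. Proof. by have := prime_gt0 p_prime; lia. Qed.

Lemma q_euclid (m n : int) : (q %| m * n)%Z = (q %| m)%Z || (q %| n)%Z.
Proof. by rewrite !dvdzE abszM Euclid_dvdM. Qed.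

Lemma q_euclid_sqr (m : int) : (q %| m ^+ 2)%Z = (q %| m)%Z.
Proof. by rewrite expr2 q_euclid orbb. Qed.

Lemma q_coprime (m : int) : ~~ (q %| m)%Z -> coprimez q m.
Proof. by rewrite dvdzE coprimezE prime_coprime. Qed.

Lemma q_ndiv2 : ~~ (q %| 2)%Z.
Proof.
rewrite dvdzE /=; apply/negP => /(dvdn_leq (isT : (0 < 2)%N)).
by have := prime_gt1 p_prime; case: p p_odd => [|[|[|]]].
Qed.

Lemma linear_root (a b : int) : ~~ (q %| a)%Z ->
  exists2 j0 : nat, (j0 < p)%N &
    forall j : nat, (j < p)%N -> (q %| b - 2 * a * j%:Z)%Z = (j == j0).
Proof.
move=> na; have n2a : ~~ (q %| 2 * a)%Z by rewrite q_euclid negb_or q_ndiv2.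
have /coprimezP[[u v] /= uv] := q_coprime n2a.
(* By Bezout v inverts 2 a modulo q, so b v is the root. *)
pose r := ((b * v) %% q)%Z.
have r0 : 0 <= r by apply: modz_ge0 q_neq0.
have rq : r < q by apply: ltz_pmod; have := prime_gt0 p_prime; lia.
exists (absz r); first by lia.
move=> j lt_jp.
have -> : b - 2 * a * j%:Z = (b * u + 2 * a * ((b * v) %/ q)%Z) * q +
  2 * a * (r - j%:Z).
  have e := divz_eq (b * v) q; rewrite -/r in e.
  transitivity (b * (u * q + v * (2 * a)) - 2 * a * j%:Z); first by rewrite uv;
    ring.
  transitivity (b * u * q + 2 * a * (b * v) - 2 * a * j%:Z); first by ring.
  by rewrite {1}e; ring.
rewrite dvdz_addr; last exact: dvdz_mull.
rewrite q_euclid (negPf n2a) /=.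
apply/idP/eqP => [/dvdzP[k hk]|->]; last by rewrite gez0_abs // subrr dvdz0.
have k0 : k = 0 by nia.
by move: hk; rewrite k0; lia.
Qed.

(* f is the composite of an integral form with the matrix (q 0; 0 1), resp.
   with (1 j; 0 q); hecke_unique says that exactly one of these occurs. *)
Definition hecke_inf (f : form) := (q ^+ 2 %| f.1.1)%Z && (q %| f.1.2)%Z.
Definition hecke_fin (j : nat) (f : form) :=
  (q %| f.1.2 - 2 * f.1.1 * j%:Z)%Z &&
  (q ^+ 2 %| f.1.1 * j%:Z ^+ 2 - f.1.2 * j%:Z + f.2)%Z.

Variables (D : int) (qD : (q %| D)%Z) (qqD : ~~ (q ^+ 2 %| D)%Z).

(** If q does not divide a, then 4 a (a j^2 - b j + c) = (b - 2 a j)^2 - q^2 D leaves only the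
    linear congruence. If q divides a exactly once, then q divides b and c, and the same argument
    applies to f/q, whose discriminant D is divisible by q. If q^2 divides a, a finite j would force
    q^2 to divide D. *)
Lemma hecke_unique (f : form) : disc f = q ^+ 2 * D ->
  (hecke_inf f /\ forall j, (j < p)%N -> ~~ hecke_fin j f) \/
  (~~ hecke_inf f /\ exists2 j0 : nat, (j0 < p)%N &
     forall j, (j < p)%N -> hecke_fin j f = (j == j0)).
Proof.
case: f => [[a b] c]; rewrite /disc /hecke_inf /hecke_fin /= => fD.
have q0 := q_neq0.
have qM m n : (q * m == q * n) = (m == n) by apply: inj_eq; apply: mulfI.
have q2 : ~~ (q %| 4%:Z)%Z by rewrite (_ : 4%:Z =
  2 * 2) // q_euclid orbb q_ndiv2.
have qq_q m : (q ^+ 2 %| q * m)%Z = (q %| m)%Z by rewrite expr2 dvdz_mul2l.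
have [/dvdzP[a1 aE]|na] := boolP (q %| a)%Z; last first.
  right; split; first by apply: contra na => /andP[h _]; apply: dvdz_trans h;
    rewrite expr2 dvdz_mulr.
  have [j0 lt_j0 hj0] := linear_root b na; exists j0 => // j lt_j.
  rewrite -hj0 //; apply/andb_idr => h.
  have c4a : coprimez (q ^+ 2) (4%:Z * a).
    by apply: coprimezXl; apply: q_coprime; rewrite q_euclid negb_or q2.
  rewrite -(Gauss_dvdzr _ c4a).
  have -> : 4%:Z * a * (a * j%:Z ^+ 2 - b * j%:Z + c) =
    (b - 2 * a * j%:Z) ^+ 2 - q ^+ 2 * D.
    by rewrite -fD; ring.
  by rewrite dvdz_subl; [apply: dvdz_exp2r | apply: dvdz_mulr].
have /dvdzP[b1 bE] : (q %| b)%Z.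
  rewrite -q_euclid_sqr; have -> : b ^+ 2 = q * (q * D + 4%:Z * a1 * c).
    by move: fD; rewrite aE => fD; rewrite -[b ^+ 2](subrK (4%:Z * (a1 * q) *
      c)) fD; ring.
  by rewrite dvdz_mulr.
subst a b.
have D1 : q * D = q * b1 ^+ 2 - 4%:Z * a1 * c.
  by apply: (mulfI q0); rewrite mulrA -expr2 -fD; ring.
have [/dvdzP[a2 aE]|na1] := boolP (q %| a1)%Z.
  left; subst a1; split; first by rewrite -mulrA -expr2; apply/andP; split;
    apply: dvdz_mull.
  move=> j lt_j; apply/negP => /andP[_ hj].
  have D2 : D = b1 ^+ 2 - 4%:Z * a2 * c by apply: (mulfI q0); rewrite D1; ring.
  have /dvdzP[c1 cE] : (q %| c)%Z.
    have -> : c = (a2 * q * q * j%:Z ^+ 2 - b1 * q * j%:Z +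
      c) - q * (a2 * q * j%:Z ^+ 2 - b1 * j%:Z) by ring.
    rewrite dvdz_subl; last exact: dvdz_mulr.
    by apply: dvdz_trans hj; rewrite expr2 dvdz_mulr.
  subst c.
  have /dvdzP[b2 bE] : (q %| b1)%Z.
    rewrite -q_euclid_sqr; have -> : b1 ^+ 2 =
      D + q * (4%:Z * a2 * c1) by rewrite D2; ring.
    by rewrite dvdz_addl //; apply: dvdz_mulr.
  subst b1; move: hj.
  have -> : a2 * q * q * j%:Z ^+ 2 - b2 * q * q * j%:Z + c1 * q =
     q ^+ 2 * (a2 * j%:Z ^+ 2 - b2 * j%:Z) + q * c1 by ring.
  rewrite dvdz_addr; last exact: dvdz_mulr.
  rewrite qq_q => /dvdzP[c2 cE]; subst c1.
  case/negP: qqD; rewrite D2.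
  have -> : (b2 * q) ^+ 2 - 4%:Z * a2 * (c2 * q * q) =
    q ^+ 2 * (b2 ^+ 2 - 4%:Z * a2 * c2) by ring.
  by rewrite dvdz_mulr.
right; split; first by rewrite (mulrC a1) qq_q (negPf na1).
have [j0 lt_j0 hj0] := linear_root b1 na1; exists j0 => // j lt_j.
rewrite -hj0 //.
have -> : (q %| b1 * q - 2 * (a1 * q) * j%:Z)%Z.
  have -> : b1 * q - 2 * (a1 * q) * j%:Z = q * (b1 - 2 * a1 * j%:Z) by ring.
  by rewrite dvdz_mulr.
have /dvdzP[c1 cE] : (q %| c)%Z.
  have : (q %| 4%:Z * a1 * c)%Z.
    have -> : 4%:Z * a1 * c = q * (b1 ^+ 2 - D) by rewrite mulrBr D1; ring.
    by rewrite dvdz_mulr.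
  by rewrite !q_euclid (negPf q2) (negPf na1).
subst c; have D2 : D = b1 ^+ 2 - 4%:Z * a1 * c1 by apply: (mulfI q0);
  rewrite D1; ring.
have -> : a1 * q * j%:Z ^+ 2 - b1 * q * j%:Z + c1 * q =
  q * (a1 * j%:Z ^+ 2 - b1 * j%:Z + c1) by ring.
rewrite andTb qq_q -[RHS]q_euclid_sqr.
have -> : (b1 - 2 * a1 * j%:Z) ^+ 2 = D + 4%:Z * a1 * (a1 * j%:Z ^+ 2 - b1 *
  j%:Z + c1) by rewrite D2; ring.
by rewrite [RHS]dvdz_addr // !q_euclid (negPf q2) (negPf na1).
Qed.

Local Open Scope classical_set_scope.

(** The forms of type [hecke_inf] are f(q x, y) and contribute S(D). Those of type [hecke_fin j] are
    f(x + j y, q y), with last coefficient f(j, q); by Zagier they contribute q^6 S(D) for each of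
    the q values of j. *)
Lemma zsum0_hecke : nonsquare D -> zsum0 (q ^+ 2 * D) = (1 + q ^+ 7) * zsum0 D.
Proof.
move=> nsD; have q0 := q_neq0; have p0 := prime_gt0 p_prime.
have qq0 : 0 < q ^+ 2 by rewrite exprn_gt0 //; lia.
pose Z := zforms (q ^+ 2 * D) 0 1.
have Zfin : finite_set Z := finite_zforms _ 0 (oner_neq0 int).
rewrite zsum0E -/Z.
have -> : \sum_(f \in Z) f.2 ^+ 3 = \sum_(f \in Z) ((if hecke_inf f then f.2 ^+
  3 else 0) +
    \sum_(j < p) (if hecke_fin j f then f.2 ^+ 3 else 0)).
  apply: eq_fsbigr => f; rewrite inE => -[fD _ _].
  have [[-> fin]|[/negPf-> [j0 lt_j0 fin]]] := hecke_unique fD.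
    by rewrite big1 ?addr0 // => j _; rewrite ifN // fin.
  rewrite add0r (bigD1 (Ordinal lt_j0)) //= fin // eqxx big1 ?addr0 // =>
    j ne_j.
  by rewrite fin //; case: eqP => // e; case/eqP: ne_j; apply: val_inj.
rewrite fsumD // fsum_exchange // fsum_cond.
have -> : \sum_(f \in Z `&` [set f | hecke_inf f]) f.2 ^+ 3 = zsum0 D.
  pose h (f : form) : form := (q ^+ 2 * f.1.1, q * f.1.2, f.2).
  pose g (f : form) : form := ((f.1.1 %/ (q ^+ 2))%Z, (f.1.2 %/ q)%Z, f.2).
  have hd f : disc (h f) = q ^+ 2 * disc f by rewrite /disc /h /=; ring.
  have gK f : hecke_inf f -> h (g f) = f.
    case: f => -[a b] c /andP[/= ha hb].
    by rewrite /h /g /= mulrC divzK // mulrC divzK.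
  rewrite zsum0E (@reindex_fsbig_can _ _ _ _ _ h g (zforms D 0 1)) //.
    move=> [[a b] c] [fD /= a0 c0]; rewrite qf01 /= in c0.
    split; last by rewrite /h /g /= !mulKz // expf_neq0.
    split; last by apply/andP; split; apply: dvdz_mulr.
    by split; rewrite ?hd ?fD ?qf01 //= pmulr_rlt0.
  move=> f [[fD a0]]; rewrite qf01 => c0 /= hf; have e := gK f hf.
  split=> //; split; last by rewrite qf01.
    by apply: (@mulfI _ (q ^+ 2)); rewrite ?expf_neq0 // -hd e.
  by rewrite -(pmulr_rlt0 _ qq0); have := congr1 (fun u : form => u.1.1) e =>
    /= ->.
rewrite mulrDl mul1r; congr (_ + _).
have -> : q ^+ 7 * zsum0 D = \sum_(j < p) (q ^+ 6 * zsum0 D).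
  by rewrite sumr_const card_ord -mulr_natl natz; ring.
apply: eq_bigr => -[j lt_j] _ /=; rewrite -(zsum_const nsD j p0) fsum_cond.
pose h (f : form) : form := (f.1.1, 2 * f.1.1 * j%:Z + q * f.1.2, qf f j%:Z q).
pose b' (f : form) : int := ((f.1.2 - 2 * f.1.1 * j%:Z) %/ q)%Z.
pose g (f : form) : form := (f.1.1, b' f,
   ((f.1.1 * j%:Z ^+ 2 - f.1.2 * j%:Z + f.2) %/ (q ^+ 2))%Z).
have hd f : disc (h f) = q ^+ 2 * disc f by rewrite /disc /h /qf /=; ring.
have gK f : hecke_fin j f -> h (g f) = f.
  case: f => -[a b] c /andP[/= hb hc].
  have e1 := divzK hb; have e2 := divzK hc.
  rewrite /h /g /b' /qf /=; congr (_, _, _); first by rewrite (mulrC q) e1;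
    ring.
  by rewrite e2 (mulrAC _ j%:Z q) e1; ring.
rewrite /zsum (@reindex_fsbig_can _ _ _ _ _ h g (zforms D j q)) //.
  move=> [[a b] c] [fD /= a0 v0].
  have hb : b * q = (2 * a * j%:Z + q * b) - 2 * a * j%:Z by ring.
  have hc : c * q ^+ 2 = a * j%:Z ^+ 2 - (2 * a * j%:Z + q * b) * j%:Z +
    qf (a, b, c) j%:Z q.
    by rewrite /qf /=; ring.
  split; last by rewrite /h /g /b' /= -hb -hc !mulzK // expf_neq0.
  split; last by rewrite /= /hecke_fin /= -hb -hc; apply/andP; split;
    apply: dvdz_mull.
  by split; rewrite ?hd ?fD ?qf01.
move=> f [[fD a0]]; rewrite qf01 => c0 /= hf; have e := gK f hf.
split=> //; split=> //.
  by apply: (@mulfI _ (q ^+ 2)); rewrite ?expf_neq0 // -hd e.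
by have := congr1 (fun u : form => u.2) e => /= ->.
Qed.
End Hecke.

(** * The congruence *)

Section Congruence.
Local Open Scope classical_set_scope.
Local Notation form := (int * int * int)%type.

(** The value at m = 0 is 0, so truncated differences N - k^2 add nothing. *)
Definition sigma3_quarter (m : nat) : nat :=
  if (4 %| m)%N then sigma3 (m %/ 4) else 0.

(** The number of integers of absolute value k. *)
Definition sym_weight (k : nat) : nat := if k == 0%N then 1 else 2.

Lemma sigma3_quarterE m n : (m <= n)%N -> sigma3_quarter m =
  (\sum_(c <- iota 1 n) if (0 < m) && (4 * c %| m) then c ^ 3 else 0)%N.
Proof.
move=> le_mn; rewrite /sigma3_quarter /sigma3.
have [->|m0] := posnP m; first by rewrite dvdn0 div0n big_nil big1.
case: ifP => [/dvdnP[k mE]|nd]; last first.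
  by rewrite big1 // => c _; rewrite andTb ifN //;
    apply/negP => /(dvdn_trans (dvdn_mulr c (dvdnn 4))); rewrite nd.
subst m; rewrite mulnK //; have k0 : (0 < k)%N by lia.
have -> : iota 1 n = iota 1 k ++ iota k.+1 (n - k) by rewrite -add1n -iotaD
  subnKC //; lia.
rewrite big_cat /= [X in (_ + X)%N]big_seq [X in (_ + X)%N]big1 ?addn0.
  by rewrite big_mkcond; apply: eq_bigr => c _; rewrite mulnC dvdn_pmul2r.
move=> c; rewrite mem_iota => /andP[lt_kc _];
  rewrite ifN // mulnC dvdn_pmul2r //.
by apply/negP => /(dvdn_leq k0); lia.
Qed.

(** A form with a < 0 < c amounts to b and a factorization (N - b^2)/4 = (-a) c; b and -b are
    grouped together. *)
Lemma zsum0_nat (N M : nat) : (forall k, (k ^ 2 < N)%N -> (k <= M)%N) ->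
  zsum0 N = (\sum_(k < M.+1) sym_weight k * sigma3_quarter (N - k ^ 2))%N%:Z.
Proof.
move=> hM; rewrite zsum0E; pose Z := zforms N 0 1; rewrite -/Z.
have Zfin : finite_set Z := finite_zforms _ 0 (oner_neq0 int).
have Zfin' A : finite_set (Z `&` A) by apply: finite_setIl.
rewrite (fsumID [set f : form | 0 <= f.1.2] _ Zfin).
have -> : \sum_(f \in Z `&` ~` [set f : form | 0 <= f.1.2]) f.2 ^+ 3 =
  \sum_(f \in Z `&` [set f : form | 0 <= f.1.2]) (if 0 < f.1.2 then f.2 ^+ 3
    else 0).
  pose h (f : form) : form := (f.1.1, - f.1.2, f.2).
  have hd f : disc (h f) = disc f by rewrite /disc /h /=; ring.
  have hK f : h (h f) = f by case: f => -[a b] c; rewrite /h /= opprK.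
  rewrite fsum_cond [RHS](@reindex_fsbig_can _ _ _ _ _ h h (Z `&` ~` [set f :
    form | 0 <= f.1.2])) //.
    move=> f [[fD a0]]; rewrite qf01 => c0 /= b0; split=> //.
    by split; [split; [split|]|]; rewrite ?hd ?qf01 // /h /=; lia.
  move=> f [[[fD a0]]]; rewrite qf01 => c0 _ /= b0; split=> //.
  by split; [split|]; rewrite ?hd ?qf01 // /h /=; lia.
rewrite -fsumD //.
pose P (u : nat * nat) := (0 < N - u.1 ^ 2)%N && (4 * u.2 %| N - u.1 ^ 2)%N &&
  (0 < u.2)%N.
pose r := allpairs pair (iota 0 M.+1) (iota 1 N).
have ur : uniq r by apply: allpairs_uniq; rewrite ?iota_uniq // => -[? ?] [? ?].
transitivity (\sum_(u <- r | P u) (sym_weight u.1 * u.2 ^ 3)%:Z); last first.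
  rewrite [LHS]big_mkcond big_allpairs -[iota 0 M.+1]/(index_iota 0 M.+1).
  rewrite raddf_sum /= -(big_mkord xpredT (fun k =>
    (sym_weight k * sigma3_quarter (N - k ^ 2))%:Z)).
  apply: eq_bigr => k _.
  rewrite (@sigma3_quarterE _ N) ?leq_subr // big_distrr raddf_sum /=.
  rewrite !big_seq; apply: eq_bigr => c; rewrite mem_iota => /andP[c0 _].
  by rewrite /P /= c0 andbT; case: ifP; rewrite ?muln0.
rewrite [RHS]bigfs //; last first.
  move=> [k c]; rewrite /P /= => /andP[/andP[k0 ck] c0] nr; case/negP: nr.
  apply/allpairsP; exists (k, c); split=> //; rewrite mem_iota /=.
    by rewrite add0n ltnS hM // -subn_gt0.
  by rewrite c0 add1n ltnS; have := dvdn_leq k0 ck; lia.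
pose h (f : form) : nat * nat := (absz f.1.2, absz f.2).
pose g (u : nat * nat) : form := (- ((N - u.1 ^ 2) %/ (4 * u.2))%N%:Z, u.1%:Z,
  u.2%:Z).
rewrite [RHS](@reindex_fsbig_can _ _ _ _ _ h g (Z `&` [set f : form | 0 <=
  f.1.2])).
- apply: eq_fsbigr => -[[a b] c]; rewrite inE => -[[_ _]];
  rewrite qf01 /= => c0 b0.
  have cE : (absz c)%:Z = c by lia.
  rewrite /h /sym_weight /= PoszM absz_eq0.
  have -> : (absz c ^ 3)%N%:Z = c ^+ 3 by rewrite -{2}cE -rmorphXn.
  have [->|bN0] := eqVneq b 0; first by rewrite ltxx mul1r addr0.
  by rewrite lt_def bN0 b0 (_ : Posz 2 = 1 + 1) // mulrDl mul1r.
- move=> [[a b] c] [[fD a0]]; rewrite qf01 /= in fD a0 * => c0 b0.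
  have bE : (absz b)%:Z = b by lia.
  have cE : (absz c)%:Z = c by lia.
  have aE : (absz a)%:Z = - a by lia.
  have e : (N - absz b ^ 2 = 4 * absz c * absz a)%N.
    move: fD; rewrite /disc /=; nia.
  split; last first.
    by rewrite /h /g /= e mulKn; [rewrite aE opprK bE cE | lia].
  have hP : P (h (a, b, c)) by rewrite /P /h /= e dvdn_mulr // andbT !muln_gt0;
    lia.
  exact: hP.
move=> [k c] /= /andP[/andP[k0 /dvdnP[d dE]] c0].
have d0 : (0 < d)%N by move: k0; rewrite dE; case: (d).
rewrite /h /g /= dE mulnK; last by lia.
split=> //; split; last by [].
have NE : N%:Z = k%:Z ^+ 2 + d%:Z * (4%:Z * c%:Z).
  rewrite expr2 -!PoszM -PoszD mulnn -dE subnKC //; apply: ltnW;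
    rewrite -subn_gt0.
  by rewrite dE; lia.
by split; rewrite ?qf01 /disc /= ?NE; [ring | rewrite oppr_lt0 | ].
Qed.

Lemma sum_even_terms m (g : nat -> nat) : (forall k, odd k -> g k = 0%N) ->
  (\sum_(k < m.*2.+1) g k = \sum_(j < m.+1) g j.*2)%N.
Proof.
move=> g0; elim: m => [|m IHm]; first by rewrite !big_ord1.
rewrite doubleS 2!big_ord_recr IHm [RHS]big_ord_recr /= g0 ?addn0 //=.
by rewrite odd_double.
Qed.

(** An odd square is 1 mod 4, so 4 divides this difference only when it is truncated to 0. *)
Lemma sigma3_quarter_odd n k : odd k -> sigma3_quarter (4 * n - k ^ 2) = 0%N.
Proof.
move=> ok; rewrite /sigma3_quarter; case: ifP => // dv.
have kE := odd_double_half k; rewrite ok -mul2n in kE.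
have -> : (4 * n - k ^ 2 = 0)%N by nia.
by rewrite div0n /sigma3 big_nil.
Qed.

Local Notation F := 'F_11.

(** Multiply w by the Eisenstein series [weight4]. For discriminant 4 n the middle coefficient is
    even, b = 2 k, which turns sigma_3((4 n - b^2)/4) into sigma_3(n - k^2). *)
Lemma pbar11_zsum0 n : nonsquare n%:Z -> (pbar (11 * n))%:R =
  16%:R * (-1) ^+ n * (16%:R * (zsum0 n%:Z)%:~R - (zsum0 (4 * n)%N%:Z)%:~R) :> F.
Proof.
move=> nsn.
have nsq k : (k ^ 2 != n)%N.
  by apply: contra (nsn k%:Z) => /eqP <-; rewrite -rmorphXn.
have -> : (pbar (11 * n))%:R = pbar_ser F (11 * n)%N by [].
rewrite pbar11 -/weight4.
have le_sq k : (k <= k ^ 2)%N by case: k => // k; rewrite expnS leq_pmulr.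
transitivity (\sum_(k < n.+1) (sym_weight k)%:R * ((-1) ^+ k * (if (k ^ 2 <=
  n)%N then weight4 (n - k ^ 2)%N else 0))).
  rewrite -(@eq_coefM _ (theta4_part F n) weight4) => [|i hi|//];
    last exact: coef_theta4_part.
  rewrite /theta4_part mulrDl mul1r coefDf -mulrA coef_natM mulr_suml coef_sumf.
  rewrite big_ord_recl /= subn0 mulr_sumr !mul1r; congr (_ + _).
  apply: eq_bigr => k _; rewrite -mulrA coef_signM coef_fXnM /sym_weight /=.
  by rewrite ltnNge; case: leqP.
have h1 : (zsum0 n%:Z)%:~R = \sum_(k < n.+1) (sym_weight k)%:R * (sigma3_quarter
  (n - k ^ 2))%:R :> F.
  rewrite (@zsum0_nat n n); last by move=> k; have := le_sq k; lia.
  by rewrite -pmulrn natr_sum; apply: eq_bigr => k _; rewrite natrM.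
have h2 : (zsum0 (4 * n)%N%:Z)%:~R = \sum_(k < n.+1) (sym_weight k)%:R * (sigma3
  (n - k ^ 2))%:R :> F.
  rewrite (@zsum0_nat (4 * n) (n.*2)); last by move=> k; nia.
  rewrite -pmulrn (@sum_even_terms n (fun k =>
    sym_weight k * sigma3_quarter (4 * n - k ^ 2)))%N => [|k ok];
    last by rewrite sigma3_quarter_odd ?muln0.
  rewrite natr_sum; apply: eq_bigr => j _; rewrite natrM; congr (_ * _%:R).
    by rewrite /sym_weight double_eq0.
  rewrite -mul2n expnMn -mulnBr /sigma3_quarter dvdn_mulr // mulKn //.
rewrite h1 h2 !mulr_sumr -sumrB mulr_sumr; apply: eq_bigr => i _.
move: (nat_of_ord i) => k {i}.
have s0 : sigma3 0 = 0%N by rewrite /sigma3 big_nil.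
case: leqP => [le_kn|lt_nk]; last first.
  have -> : (n - k ^ 2 = 0)%N by apply/eqP; rewrite subn_eq0 ltnW.
  by rewrite /sigma3_quarter /= s0 !mulr0 subr0 mulr0.
(* Since n is not a square, the constant term of [weight4], which [weight4_sigma3] leaves out, never
   enters. *)
have m0 : (0 < n - k ^ 2)%N by rewrite subn_gt0 ltn_neqAle nsq.
rewrite weight4_sigma3 //; have nE := subnK le_kn.
set m := (n - k ^ 2)%N in m0 nE *.
have sgn : (-1) ^+ k * (-1) ^+ m = (-1) ^+ n :> F.
  rewrite -exprD -signr_odd -[in RHS]signr_odd; congr (_ ^+ _).
  by rewrite -nE !oddD oddX /= addbC.
have -> : dil 4 sigma3_ser m = (sigma3_quarter m)%:R.
  by rewrite coef_dil /sigma3_quarter; case: ifP.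
(* If 4 divides m then (-1)^m = 1, so (-1)^k = (-1)^n; otherwise both sides vanish. *)
have q : (-1) ^+ k * (sigma3_quarter m)%:R =
  (-1) ^+ n * (sigma3_quarter m)%:R :> F.
  have [dv|ndv] := boolP (4 %| m)%N; last by rewrite /sigma3_quarter (negPf ndv)
    !mulr0.
  rewrite -sgn; have -> : (-1) ^+ m = 1 :> F; last by rewrite mulr1.
  by rewrite -signr_odd; case/dvdnP: dv => d ->; rewrite oddM andbF.
have -> : sigma3_ser m = (sigma3 m)%:R by [].
transitivity ((sym_weight k)%:R * (16%:R * (16%:R * ((-1) ^+ k * (sigma3_quarter
  m)%:R)
   - ((-1) ^+ k * (-1) ^+ m) * (sigma3 m)%:R)) : F); first by ring.
by rewrite q sgn; ring.
Qed.
End Congruence.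

Local Close Scope ring_scope.

Theorem theorem1p4 (Q : nat) (hQ : prime Q) (hQ11 : Q = 10 %[mod 11])
    (n : nat) (hn : 0 < n) (hnQ : coprime n Q) :
  pbar (11 * Q ^ 3 * n) = 0 %[mod 11].
Proof.
have oQ : odd Q by case: (even_prime hQ) => // e; move: hQ11; rewrite e.
have Q0 := prime_gt0 hQ; have Q1 := prime_gt1 hQ.
have nQ : ~~ (Q %| n) by rewrite -prime_coprime // coprime_sym.
have n4Q : ~~ (Q %| 4 * n).
  rewrite Euclid_dvdM // negb_or nQ andbT -[4]/(2 * 2) Euclid_dvdM // orbb.
  by apply/negP => /(dvdn_leq (isT : 0 < 2)); case: (Q) oQ Q1 => [|[|[|]]].
have nsq D : (Q %| D)%N -> ~~ (Q ^ 2 %| D) -> nonsquare D%:Z.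
  move=> QD QQD k; apply: contra QQD => /eqP kD.
  have e : (absz k ^ 2 = D)%N by apply/eqP; rewrite -eqz_nat -kD -abszX; lia.
  by rewrite -e; apply: dvdn_exp2r; move: QD; rewrite -e Euclid_dvdX // andbT.
have hecke m : ~~ (Q %| m) -> ((zsum0 (Q ^ 2 * (Q * m))%N%:Z)%:~R = 0 :> 'F_11)%R.
  move=> nm; have QD : Q %| Q * m by apply: dvdn_mulr.
  have QQD : ~~ (Q ^ 2 %| Q * m) by rewrite expnS expn1 dvdn_pmul2l.
  rewrite PoszM -mulnn PoszM -expr2 (@zsum0_hecke Q hQ oQ) //; last exact: nsq.
  rewrite intrM; suff -> : ((1 + Q%:Z ^+ 7)%:~R =
    0 :> 'F_11)%R by rewrite mul0r.
  (* Here Q is -1 mod 11 and 7 is odd, so 1 + Q^7 = 0. *)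
  rewrite rmorphD rmorphXn rmorph1 /= -pmulrn -(@Fp_nat_mod 11) // hQ11.
  exact/eqP.
suff h : ((pbar (11 * (Q ^ 3 * n)))%:R = 0 :> 'F_11)%R.
  apply/eqP; rewrite mod0n -/(dvdn 11 _) -mulnA.
  by rewrite (dvdn_pcharf (pchar_Fp (isT : prime 11))) h.
have -> : Q ^ 3 * n = Q ^ 2 * (Q * n) by rewrite mulnA -expnSr.
(* A square root would be divisible by Q, and dividing by Q^2 would make Q n a square. *)
have nsD : nonsquare (Q ^ 2 * (Q * n))%N%:Z.
  move=> k; apply/eqP => kD.
  have /dvdzP[j kE] : (Q%:Z %| k)%Z.
    by rewrite -q_euclid_sqr // kD dvdzE /= expnS -mulnA dvdn_mulr.
  have QQD : ~~ (Q ^ 2 %| Q * n) by rewrite expnS expn1 dvdn_pmul2l.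
  case/eqP: (nsq (Q * n) (dvdn_mulr _ (dvdnn Q)) QQD j).
  have q0 : (Q%:Z ^+ 2 != 0)%R by rewrite expf_neq0 // (q_neq0 hQ).
  apply: (mulfI q0); rewrite (_ : Q%:Z ^+ 2 * j ^+ 2 = k ^+ 2)%R;
    last by rewrite kE; ring.
  by rewrite kD PoszM -mulnn PoszM expr2.
rewrite pbar11_zsum0 // hecke //.
(* The second sum vanishes too, because Q does not divide 4 n. *)
have -> : 4 * (Q ^ 2 * (Q * n)) = Q ^ 2 * (Q * (4 * n)) by ring.
by rewrite hecke // !mulr0 subrr mulr0.
Qed.
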